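(* Let $0<\varepsilon\le 1$ and let $\rho=|\psi\rangle\langle\psi|$ be a (normalized, pure) $n$-particle fermionic state on $m$ modes. Assume we have an estimator $\hat\gamma$ for the one-particle reduced density matrix $\gamma_{ij}=\operatorname{Tr}(c_j^\dagger c_i\rho)$ satisfying $\|\hat\gamma-\gamma\|<\varepsilon/(8n)$ (operator norm), together with classical query access to the amplitudes $\langle S|\psi\rangle$ of $|\psi\rangle$ on Slater determinants $|S\rangle$. Then we can find the closest Slater determinant to $\rho$, as measured by fidelity, to an additive error $\varepsilon$, i.e. a Slater determinant $|S\rangle\in\mathcal S$ with $$\langle S|\rho|S\rangle\ \ge\ \mathsf{OPT}-\varepsilon,$$ in time $$\exp\!\left[O\!\left(\frac{n^3}{\varepsilon}\log\frac{n}{\varepsilon}\right)\right]$$ on a classical computer.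
   Context: Let $\mathcal H_1$ be a complex Hilbert space of dimension $m$ (single-particle space), $n\le m$, and $\mathcal H_n=\wedge^n\mathcal H_1$. The operators $c_1^\dagger,\dots,c_m^\dagger$ are fermionic creation operators for an orthonormal basis of $\mathcal H_1$, satisfying the canonical anticommutation relations, and $|0\rangle$ is the vacuum. The set of Slater determinants is $\mathcal S=\{|\varphi_1\rangle\wedge\cdots\wedge|\varphi_n\rangle : |\varphi_i\rangle\in\mathcal H_1,\ \langle\varphi_i|\varphi_j\rangle=\delta_{ij}\}$, normalized so that its elements are unit vectors; a Slater determinant is specified by an $m\times n$ matrix $U$ with $U^\dagger U=1$ via $|S\rangle=d_1^\dagger\cdots d_n^\dagger|0\rangle$, $d_i^\dagger=\sum_j U_{ji}c_j^\dagger$. The fidelity of $|S\rangle$ is $\langle S|\rho|S\rangle$, and the optimum is $\mathsf{OPT}=\max_{|S\rangle\in\mathcal S}\langle S|\rho|S\rangle$. Query access to the amplitudes means that, for a specified Slater determinant $|S\rangle$, the value $\langle S|\psi\rangle$ can be obtained efficiently.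
   Formalization: The total time is bounded by exp[O((n^3/ε) log(n/ε))] times a fixed power of m and an absolute constant, since reading the estimator already takes time growing with m; only the number of amplitude queries is bounded without m. Time is counted in exact real arithmetic. *)

(* Defs.v *)
From HB Require Import structures.
From mathcomp Require Import all_boot all_order all_algebra.
From mathcomp Require Import all_classical all_reals all_analysis.
From mathcomp Require Import complex.

Set Implicit Arguments.
Unset Strict Implicit.
Unset Printing Implicit Defensive.

Import Order.TTheory GRing.Theory Num.Theory.
Local Open Scope ring_scope.
Local Open Scope complex_scope.
Local Open Scope sesquilinear_scope.

(* The Fock space on m modes is C^(2^m); its coordinates are indexed by the
   enumeration of the sets A of occupied modes, and the basis vector indexed by
   A = {j_1 < ... < j_k} is c_(j_1)^dagger ... c_(j_k)^dagger |0>. *)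
Definition fock_dim (m : nat) : nat := #|{set 'I_m}|.
Notation fock R m := 'cV[R[i]]_(fock_dim m).
Notation fock_op R m := 'M[R[i]]_(fock_dim m).

(* Jordan-Wigner sign: c_i^dagger anticommutes past the occupied modes j < i. *)
Definition creation (R : realType) (m : nat) (i : 'I_m) : fock_op R m :=
  \matrix_(a, b)
    let A : {set 'I_m} := enum_val a in
    let B : {set 'I_m} := enum_val b in
    if (i \notin B) && (A == i |: B)
    then (-1) ^+ #|[set j in B | (j < i)%N]%SET| else 0.

Definition annihilation (R : realType) (m : nat) (i : 'I_m) : fock_op R m :=
  (creation R i)^t*.

Definition vacuum (R : realType) (m : nat) : fock R m :=
  \col_a (enum_val a == finset.set0)%:R.

Definition n_particle (R : realType) (m n : nat) (psi : fock R m) : Prop :=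
  forall a, #|(enum_val a : {set 'I_m})| != n -> psi a 0 = 0.

Definition normalized (R : realType) (N : nat) (v : 'cV[R[i]]_N) : Prop :=
  v^t* *m v = 1%:M.

Definition pure_state (R : realType) (m : nat) (psi : fock R m) : fock_op R m :=
  psi *m psi^t*.

Definition rdm1 (R : realType) (m : nat) (rho : fock_op R m) : 'M[R[i]]_m :=
  \matrix_(i, j) \tr (creation R j *m annihilation R i *m rho).

Definition isometric (R : realType) (m n : nat) (U : 'M[R[i]]_(m, n)) : Prop :=
  U^t* *m U = 1%:M.

Definition orbital_creation (R : realType) (m n : nat) (U : 'M[R[i]]_(m, n))
    (i : 'I_n) : fock_op R m :=
  \sum_(j < m) U j i *: creation R j.

Definition slater (R : realType) (m n : nat) (U : 'M[R[i]]_(m, n)) : fock R m :=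
  (\big[mulmx/1%:M]_(i < n) orbital_creation U i) *m vacuum R m.

Definition slater_set (R : realType) (m n : nat) : set (fock R m) :=
  [set slater U | U in [set U : 'M[R[i]]_(m, n) | isometric U]]%classic.
Arguments slater_set : clear implicits.

(* <S|rho|S> is real when rho is a state, so only its real part is kept. *)
Definition fidelity (R : realType) (m : nat) (rho : fock_op R m)
    (S : fock R m) : R :=
  complex.Re ((S^t* *m rho *m S) 0 0).

(* For n <= m this is the supremum of a nonempty bounded set, and it is attained
   because the isometries form a compact set. *)
Definition OPT (R : realType) (m n : nat) (rho : fock_op R m) : R :=
  sup [set fidelity rho S | S in slater_set R m n]%classic.

Definition amplitude (R : realType) (m n : nat) (psi : fock R m)
    (U : 'M[R[i]]_(m, n)) : R[i] :=
  ((slater U)^t* *m psi) 0 0.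

Definition vnorm (R : realType) (N : nat) (v : 'cV[R[i]]_N) : R :=
  Num.sqrt (complex.Re ((v^t* *m v) 0 0)).

Definition opnorm (R : realType) (N : nat) (A : 'M[R[i]]_N) : R :=
  sup [set vnorm (A *m v) | v in [set v : 'cV[R[i]]_N | vnorm v = 1]]%classic.

(* The classical computer is a unit-cost real RAM with an oracle.
   A machine has natural-number registers, used for counting and addressing, and
   arrays of exact complex numbers; array a has cells (a, i, j) for all naturals
   i and j.  Programs are finite pieces of syntax that contain no real constant,
   so one program has to serve all m, n, epsilon and all inputs.
   Neither multiplication or division of naturals nor any rounding from numbers
   to naturals is primitive: at unit cost these would make the machine stronger
   than an ordinary computer. *)
Inductive nexp : Type :=
| NConst of nat
| NReg of nat
| NAdd of nexp & nexp
| NSub of nexp & nexp.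

Inductive cexp : Type :=
| CNat of nexp
| CImag
| CCell of nat & nexp & nexp
| CAdd of cexp & cexp
| COpp of cexp
| CMul of cexp & cexp
| CInv of cexp
| CConj of cexp
| CSqrt of cexp.

(* BLeC compares real parts. *)
Inductive bexp : Type :=
| BLeN of nexp & nexp
| BLeC of cexp & cexp
| BNot of bexp
| BAnd of bexp & bexp.

(* Query a b i j asks the oracle about the m x n matrix stored in array a and
   puts the answer in cell (b, i, j). *)
Inductive cmd : Type :=
| Skip
| SetReg of nat & nexp
| SetCell of nat & nexp & nexp & cexp
| Query of nat & nat & nexp & nexp
| Seq of cmd & cmd
| If of bexp & cmd & cmd
| While of bexp & cmd.

Record state (R : realType) : Type := State {
  reg : nat -> nat;
  cell : nat -> nat -> nat -> R[i]
}.

Definition set_reg (R : realType) (s : state R) (x v : nat) : state R :=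
  State (fun y => if y == x then v else reg s y) (cell s).

Definition set_cell (R : realType) (s : state R) (a i j : nat) (z : R[i]) :
    state R :=
  State (reg s) (fun a' i' j' =>
    if [&& a' == a, i' == i & j' == j] then z else cell s a' i' j').

Definition read_matrix (R : realType) (m n : nat) (s : state R) (a : nat) :
    'M[R[i]]_(m, n) :=
  \matrix_(i, j) cell s a i j.

Fixpoint neval (R : realType) (s : state R) (e : nexp) : nat :=
  match e with
  | NConst k => k
  | NReg x => reg s x
  | NAdd e1 e2 => neval s e1 + neval s e2
  | NSub e1 e2 => neval s e1 - neval s e2
  end%N.

Fixpoint ceval (R : realType) (s : state R) (e : cexp) : R[i] :=
  match e with
  | CNat k => (neval s k)%:R
  | CImag => 'i
  | CCell a i j => cell s a (neval s i) (neval s j)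
  | CAdd e1 e2 => ceval s e1 + ceval s e2
  | COpp e1 => - ceval s e1
  | CMul e1 e2 => ceval s e1 * ceval s e2
  | CInv e1 => (ceval s e1)^-1
  | CConj e1 => (ceval s e1)^*
  | CSqrt e1 => sqrtC (ceval s e1)
  end.

Fixpoint beval (R : realType) (s : state R) (e : bexp) : bool :=
  match e with
  | BLeN e1 e2 => (neval s e1 <= neval s e2)%N
  | BLeC e1 e2 => complex.Re (ceval s e1) <= complex.Re (ceval s e2)
  | BNot e1 => ~~ beval s e1
  | BAnd e1 e2 => beval s e1 && beval s e2
  end.

Fixpoint ncost (e : nexp) : nat :=
  match e with
  | NConst _ | NReg _ => 1
  | NAdd e1 e2 | NSub e1 e2 => (ncost e1 + ncost e2).+1
  end%N.

Fixpoint ccost (e : cexp) : nat :=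
  match e with
  | CNat k => (ncost k).+1
  | CImag => 1
  | CCell _ i j => (ncost i + ncost j).+1
  | CAdd e1 e2 | CMul e1 e2 => (ccost e1 + ccost e2).+1
  | COpp e1 | CInv e1 | CConj e1 | CSqrt e1 => (ccost e1).+1
  end%N.

Fixpoint bcost (e : bexp) : nat :=
  match e with
  | BLeN e1 e2 => (ncost e1 + ncost e2).+1
  | BLeC e1 e2 => (ccost e1 + ccost e2).+1
  | BNot e1 => (bcost e1).+1
  | BAnd e1 e2 => (bcost e1 + bcost e2).+1
  end%N.

(* exec O c s t q s': with oracle O, command c started in s halts in s' after
   t time steps and q oracle queries.  A query costs the m * n steps needed to
   transmit the matrix.  There is no rule for a query on a matrix that is not an
   isometry, so a program issuing one does not halt in the sense of exec. *)
Inductive exec (R : realType) (m n : nat) (O : 'M[R[i]]_(m, n) -> R[i]) :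
    cmd -> state R -> nat -> nat -> state R -> Prop :=
| ExecSkip s : exec O Skip s 1 0 s
| ExecSetReg s x e :
    exec O (SetReg x e) s (ncost e).+1 0 (set_reg s x (neval s e))
| ExecSetCell s a i j e :
    exec O (SetCell a i j e) s (ncost i + ncost j + ccost e).+1 0
      (set_cell s a (neval s i) (neval s j) (ceval s e))
| ExecQuery s a b i j :
    isometric (read_matrix m n s a) ->
    exec O (Query a b i j) s (ncost i + ncost j + m * n).+1 1
      (set_cell s b (neval s i) (neval s j) (O (read_matrix m n s a)))
| ExecSeq s s1 s2 c1 c2 t1 t2 q1 q2 :
    exec O c1 s t1 q1 s1 -> exec O c2 s1 t2 q2 s2 ->
    exec O (Seq c1 c2) s (t1 + t2).+1 (q1 + q2) s2
| ExecIf s s1 b c1 c2 t q :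
    exec O (if beval s b then c1 else c2) s t q s1 ->
    exec O (If b c1 c2) s (bcost b + t).+1 q s1
| ExecWhileF s b c :
    ~~ beval s b -> exec O (While b c) s (bcost b).+1 0 s
| ExecWhileT s s1 s2 b c t1 t2 q1 q2 :
    beval s b -> exec O c s t1 q1 s1 -> exec O (While b c) s1 t2 q2 s2 ->
    exec O (While b c) s (bcost b + t1 + t2).+1 (q1 + q2) s2.

(* Input: register 0 holds n, register 1 holds m, array 0 holds the estimated
   one-particle density matrix and cell (1, 0, 0) holds epsilon; everything else
   is 0.  The oracle is the only access to the state psi. *)
Definition input (R : realType) (m n : nat) (eps : R) (gammah : 'M[R[i]]_m) :
    state R :=
  State
    (fun x => match x with 0 => n | 1 => m | _ => 0 end)%N
    (fun a i j =>
       match a with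
       | 0%N => match insub i, insub j with
                | Some i', Some j' => gammah i' j'
                | _, _ => 0
                end
       | 1%N => if (i == 0%N) && (j == 0%N) then eps%:C else 0
       | _ => 0
       end).

Definition output_array : nat := 2.

(* Main.v *)
Require Import Defs.
From HB Require Import structures.
From mathcomp Require Import all_boot all_order all_algebra.
From mathcomp Require Import all_classical all_reals all_analysis.
From mathcomp Require Import complex.
From mathcomp Require Import perm ring lra zify.

(* The one-particle density matrix gamma has trace n, so at most 4 n^2 / eps
   orthonormal vectors can have gamma-expectation at least eps / (4 n).  They
   need not be eigenvectors: Gram-Schmidt with respect to the form
   (threshold - gamma-hat) either succeeds, and the form is positive definite,
   or meets a nonpositive pivot, and the vector at hand is a direction of large
   occupation to be split off.  This yields exactly, without diagonalisation, a
   subspace V of dimension r <= 4 n^2 / eps outside of which every occupation is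
   at most eps / (2 n).

   The amplitude <S|psi> is multilinear and alternating in the orbitals of S, and
   replacing one orbital by the normalised projection on V lowers the squared
   amplitude by at most eps / (2 n).  So some matrix V Z with columns of norm at
   most 1 loses only eps / 2 against the optimum.  Rounding Z towards 0 on a grid
   of mesh 1 / L, with L of order n r / eps, costs another eps / 2; as rounding
   keeps the columns of norm at most 1, Hadamard's inequality shows that
   orthonormalising V Z only increases the amplitude.  Searching all
   (2 L + 1)^(2 r n) grid points gives the theorem. *)

Set Implicit Arguments.
Unset Strict Implicit.
Unset Printing Implicit Defensive.

Import Order.TTheory GRing.Theory Num.Theory.
Local Open Scope ring_scope.
Local Open Scope complex_scope.
Local Open Scope sesquilinear_scope.

(** * Inner products *)

Section Adjoint.
Variable R : realType.
Local Notation C := R[i].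

Lemma ctmxE m n (A : 'M[C]_(m, n)) i j : A^t* i j = Num.conj (A j i).
Proof. by rewrite !mxE. Qed.

Lemma ctmxK m n (A : 'M[C]_(m, n)) : A^t*^t* = A.
Proof. by apply/matrixP=> i j; rewrite !ctmxE conjCK. Qed.

Lemma ctmxM m n p (A : 'M[C]_(m, n)) (B : 'M[C]_(n, p)) :
  (A *m B)^t* = B^t* *m A^t*.
Proof. by rewrite trmx_mul map_mxM. Qed.

Lemma ctmxD m n (A B : 'M[C]_(m, n)) : (A + B)^t* = A^t* + B^t*.
Proof. by rewrite linearD map_mxD. Qed.

Lemma ctmxB m n (A B : 'M[C]_(m, n)) : (A - B)^t* = A^t* - B^t*.
Proof. by rewrite linearB map_mxB. Qed.

Lemma ctmxZ m n (a : C) (A : 'M[C]_(m, n)) : (a *: A)^t* = Num.conj a *: A^t*.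
Proof. by rewrite linearZ map_mxZ. Qed.

Lemma ctmx0 m n : (0 : 'M[C]_(m, n))^t* = 0.
Proof. by rewrite trmx0 map_mx0. Qed.

Lemma ctmx1 n : (1%:M : 'M[C]_n)^t* = 1%:M.
Proof. by rewrite trmx1 map_mx1. Qed.

Lemma ctmx_sum m n (I : finType) (F : I -> 'M[C]_(m, n)) :
  (\sum_i F i)^t* = \sum_i (F i)^t*.
Proof.
by elim/big_rec2: _ => [|i A B _ <-]; rewrite ?ctmx0 // ctmxD.
Qed.

Definition dot N (u v : 'cV[C]_N) : C := (u^t* *m v) 0 0.

Lemma dotE N (u v : 'cV[C]_N) : dot u v = \sum_i Num.conj (u i 0) * v i 0.
Proof. by rewrite /dot mxE; apply: eq_bigr => i _; rewrite ctmxE. Qed.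

Lemma dotDl N (u v w : 'cV[C]_N) : dot (u + v) w = dot u w + dot v w.
Proof. by rewrite /dot ctmxD mulmxDl mxE. Qed.
Lemma dotDr N (u v w : 'cV[C]_N) : dot u (v + w) = dot u v + dot u w.
Proof. by rewrite /dot mulmxDr mxE. Qed.
Lemma dotBl N (u v w : 'cV[C]_N) : dot (u - v) w = dot u w - dot v w.
Proof. by rewrite /dot ctmxB mulmxBl !mxE. Qed.
Lemma dotBr N (u v w : 'cV[C]_N) : dot u (v - w) = dot u v - dot u w.
Proof. by rewrite /dot mulmxBr !mxE. Qed.
Lemma dotZl N a (u v : 'cV[C]_N) : dot (a *: u) v = Num.conj a * dot u v.
Proof. by rewrite /dot ctmxZ -scalemxAl mxE. Qed.
Lemma dotZr N a (u v : 'cV[C]_N) : dot u (a *: v) = a * dot u v.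
Proof. by rewrite /dot -scalemxAr mxE. Qed.
Lemma dot0l N (v : 'cV[C]_N) : dot 0 v = 0.
Proof. by rewrite /dot ctmx0 mul0mx mxE. Qed.
Lemma dot0r N (v : 'cV[C]_N) : dot v 0 = 0.
Proof. by rewrite /dot mulmx0 mxE. Qed.
Lemma dot_sumr N (I : finType) (u : 'cV[C]_N) (F : I -> 'cV[C]_N) :
  dot u (\sum_i F i) = \sum_i dot u (F i).
Proof. by rewrite /dot mulmx_sumr summxE. Qed.
Lemma dot_conj N (u v : 'cV[C]_N) : Num.conj (dot u v) = dot v u.
Proof. by rewrite /dot -[RHS]/((v^t* *m u) 0 0) -[u in RHS]ctmxK -ctmxM ctmxE. Qed.
Lemma dot_adjl M N (A : 'M[C]_(M, N)) u v : dot (A *m u) v = dot u (A^t* *m v).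
Proof. by rewrite /dot ctmxM mulmxA. Qed.
Lemma dot_adjr M N (A : 'M[C]_(M, N)) u v : dot u (A *m v) = dot (A^t* *m u) v.
Proof. by rewrite dot_adjl ctmxK. Qed.

Lemma mx11_dot N (u v : 'cV[C]_N) : u^t* *m v = (dot u v)%:M.
Proof. exact: mx11_scalar. Qed.

Lemma mulmx_dot M N (A : 'M[C]_(M, N)) (B : 'M[C]_(M, N)) i j :
  (A^t* *m B) i j = dot (col i A) (col j B).
Proof. by rewrite mxE dotE; apply: eq_bigr => k _; rewrite ctmxE !mxE. Qed.

Definition csq (z : C) : R := complex.Re z ^+ 2 + complex.Im z ^+ 2.

Definition nsq N (v : 'cV[C]_N) : R := complex.Re (dot v v).

Lemma csq_ge0 z : 0 <= csq z.
Proof. by rewrite addr_ge0 ?sqr_ge0. Qed.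

Lemma csqM z w : csq (z * w) = csq z * csq w.
Proof. by case: z => a b; case: w => c d; rewrite /csq /=; ring. Qed.

Lemma csq_conj z : csq (Num.conj z) = csq z.
Proof. by case: z => a b; rewrite /csq /=; ring. Qed.

Lemma csqN z : csq (- z) = csq z.
Proof. by case: z => a b; rewrite /csq /=; ring. Qed.

Lemma csqE z : (csq z)%:C = Num.conj z * z.
Proof. by case: z => a b; rewrite /csq /=; simpc; congr (_ +i* _); ring. Qed.

Lemma csq0 : csq 0 = 0.
Proof. by rewrite /csq /= expr0n /= addr0. Qed.
Lemma csq1 : csq 1 = 1.
Proof. by rewrite /csq /= expr0n /= addr0 expr1n. Qed.

Lemma csqR (a : R) : csq a%:C = a ^+ 2.
Proof. by rewrite /csq /= expr0n addr0. Qed.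

Lemma csq_eq0 z : csq z = 0 -> z = 0.
Proof.
case: z => a b; rewrite /csq /= => /eqP.
by rewrite paddr_eq0 ?sqr_ge0 // !sqrf_eq0 => /andP[/eqP-> /eqP->].
Qed.

Lemma Re_sum (I : finType) (F : I -> C) :
  complex.Re (\sum_i F i) = \sum_i complex.Re (F i).
Proof.
elim/big_rec2: _ => // i x y _ <-; by case: (F i) => a b; case: y => c d.
Qed.

Lemma nsqE N (v : 'cV[C]_N) : nsq v = \sum_i csq (v i 0).
Proof.
by rewrite /nsq dotE Re_sum; apply: eq_bigr => i _; rewrite -csqE.
Qed.

Lemma dotvv N (v : 'cV[C]_N) : dot v v = (nsq v)%:C.
Proof.
rewrite nsqE dotE rmorph_sum /=; apply: eq_bigr => i _.
by rewrite -csqE.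
Qed.

Lemma nsq_ge0 N (v : 'cV[C]_N) : 0 <= nsq v.
Proof. by rewrite nsqE sumr_ge0 // => i _; apply: csq_ge0. Qed.

Lemma nsq_eq0 N (v : 'cV[C]_N) : nsq v = 0 -> v = 0.
Proof.
rewrite nsqE => /eqP; rewrite psumr_eq0 => [/allP h|i _]; last exact: csq_ge0.
apply/matrixP => i j; rewrite ord1 mxE.
by apply: csq_eq0; apply/eqP; apply: h; rewrite mem_index_enum.
Qed.

Lemma nsq0 N : nsq (0 : 'cV[C]_N) = 0.
Proof. by rewrite /nsq dot0r. Qed.

Lemma nsqZ N a (v : 'cV[C]_N) : nsq (a *: v) = csq a * nsq v.
Proof.
apply: complexI; rewrite -dotvv dotZl dotZr mulrA -csqE dotvv.
by rewrite -rmorphM.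
Qed.

Lemma nsq_proj N (v y : 'cV[C]_N) :
  nsq v * nsq y = csq (dot v y) + nsq ((nsq v)%:C *: y - dot v y *: v) / nsq v
  \/ v = 0.
Proof.
have [/nsq_eq0|nv] := eqVneq (nsq v) 0; [by right|left].
apply: complexI; rewrite rmorphD !rmorphM /= -[(nsq (_ - _))%:C]dotvv.
rewrite dotBl !dotBr !dotZl !dotZr !dotvv csqE fmorphV /=.
rewrite -[Num.conj (nsq v)%:C]/((nsq v)%:C^*%C) conjc_real.
have -> : dot y v = Num.conj (dot v y) by rewrite dot_conj.
by field; apply: contra_neq nv => /complexI.
Qed.

Lemma cauchy_schwarz N (u v : 'cV[C]_N) : csq (dot u v) <= nsq u * nsq v.
Proof.
have [->|->] := nsq_proj u v; last by rewrite dot0l csq0 nsq0 mul0r.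
by rewrite lerDl divr_ge0 ?nsq_ge0.
Qed.

End Adjoint.

(** * Slater determinants *)

Section Fock.
Variables (R : realType) (m : nat).
Local Notation C := R[i].
Implicit Types i j : 'I_m.

Lemma creationE i (A B : 'I_(fock_dim m)) :
  creation R i A B =
  if (i \notin (enum_val B : {set 'I_m})) && (enum_val A == i |: enum_val B)
  then (-1) ^+ #|[set j in (enum_val B : {set 'I_m}) | (j < i)%N]%SET| else 0.
Proof. by rewrite mxE. Qed.

Lemma annihilationE i A B : annihilation R i A B = creation R i B A.
Proof.
rewrite ctmxE creationE; case: ifP => _; last by rewrite rmorph0.
by rewrite rmorphXn rmorphN1.
Qed.

Definition jw (i : 'I_m) (A : {set 'I_m}) : C :=
  (-1) ^+ #|[set j in A | (j < i)%N]%SET|.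

Lemma jwsq i (A : {set 'I_m}) : jw i A * jw i A = 1.
Proof. by rewrite /jw -expr2 sqrr_sign. Qed.

Lemma jwU i j (A : {set 'I_m}) : j \notin A ->
  jw i (j |: A) = (if (j < i)%N then - 1 else 1) * jw i A.
Proof.
move=> jA; rewrite /jw.
case: ifP => ji.
  have -> : [set k in j |: A | (k < i)%N]%SET = j |: [set k in A | (k < i)%N]%SET.
    by apply/finset.setP=> k; rewrite !inE; case: eqVneq => //= ->.
  by rewrite cardsU1 !inE (negPf jA) /= exprS.
rewrite mul1r; congr (_ ^+ #|pred_of_set _|); apply/finset.setP=> k; rewrite !inE.
by case: eqVneq => //= ->; rewrite ji andbF.
Qed.

Lemma sum_fock (A : {set 'I_m}) (F : 'I_(fock_dim m) -> C) :
  (forall a, enum_val a != A -> F a = 0) -> \sum_a F a = F (enum_rank A).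
Proof.
move=> h; rewrite (bigD1 (enum_rank A)) //= big1 ?addr0 // => a ne.
by apply: h; apply: contra ne => /eqP <-; rewrite enum_valK.
Qed.

Lemma creation_anticomm i j :
  annihilation R i *m creation R j + creation R j *m annihilation R i =
  (i == j)%:R%:M.
Proof.
apply/matrixP => a b; rewrite mxE [X in X + _]mxE [X in _ + X]mxE.
set A : {set 'I_m} := enum_val a; set B : {set 'I_m} := enum_val b.
rewrite (@sum_fock (j |: B)); last first.
  by move=> c cB; rewrite (creationE j) (negPf cB) andbF mulr0.
rewrite (@sum_fock (B :\ i)); last first.
  move=> c cB; rewrite annihilationE creationE.
  case: ifP => [/andP[ic /eqP e]|]; last by rewrite mulr0.
  by case/eqP: cB; rewrite /B e finset.setU1K.
rewrite !annihilationE !creationE !enum_rankK -/A -/B !eqxx !andbT.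
rewrite -!/(jw _ _) !mxE.
have ab : (a == b) = (A == B) by rewrite /A /B (inj_eq enum_val_inj).
clearbody A B.
have [<-|nij] := eqVneq i j.
  rewrite ab; case: (boolP (i \in B)) => iB /=.
    rewrite finset.setD1K // !finset.setD11 eqxx /= mulr0 add0r.
    by case: (A =P B) => [_|_] /=; rewrite ?mul0r // jwsq.
  have e0 : (i \in B :\ i) = false by rewrite !inE eqxx.
  rewrite e0 /=; have -> : (B == i |: B :\ i) = false.
    by apply/negP => /eqP e; move: iB; rewrite e finset.setU11.
  rewrite mulr0 addr0.
  case: (boolP (i \in A)) => iA /=.
    rewrite mul0r; case: eqP => // e; by move: iB; rewrite -e iA.
  have -> : (i |: B == i |: A) = (A == B).
    apply/eqP/eqP => [e|-> //].
    by rewrite -(finset.setU1K iA) -e finset.setU1K.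
  by case: (A =P B) => [->|_] /=; rewrite ?mul0r // jwsq.
rewrite mul0rn.
case: (boolP (i \in B)) => iB; last first.
  have -> : (B == i |: B :\ i) = false.
    by apply/negP => /eqP e; move: iB; rewrite e finset.setU11.
  rewrite andbF mulr0 addr0.
  have -> : (j |: B == i |: A) = false.
    by apply/negP => /eqP e; move: (finset.setU11 i A); rewrite -e !inE (negPf nij) (negPf iB).
  by rewrite andbF mul0r.
rewrite finset.setD1K // eqxx finset.setD11 /=.
have jBi : (j \in B :\ i) = (j \in B) by rewrite !inE eq_sym nij.
rewrite jBi; case: (boolP (j \in B)) => jB /=; first by rewrite mulr0 mul0r addr0.
have -> : (i \notin A) && (j |: B == i |: A) = (A == j |: B :\ i).
  apply/andP/eqP => [[iA /eqP e]|->].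
    rewrite -(finset.setU1K iA) -e; apply/finset.setP => k; rewrite !inE.
    by case: (eqVneq k i) => //= ->; rewrite (negPf nij).
  split; first by rewrite !inE eqxx (negPf nij).
  by apply/eqP; rewrite finset.setUCA finset.setD1K.
case: eqP => [->|_]; last by rewrite !mul0r addr0.
rewrite jwU ?jBi //; rewrite -{2}(finset.setD1K iB) jwU ?finset.setD11 //.
case: (ltngtP i j) => [ij|ij|/val_inj e]; [ring|ring|].
by rewrite e eqxx in nij.
Qed.

Definition orb (x : 'cV[C]_m) : fock_op R m := \sum_i x i 0 *: creation R i.

Lemma orbD x y : orb (x + y) = orb x + orb y.
Proof.
by rewrite /orb -big_split; apply: eq_bigr => i _; rewrite mxE scalerDl.
Qed.

Lemma orbZ a x : orb (a *: x) = a *: orb x.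
Proof.
by rewrite /orb scaler_sumr; apply: eq_bigr => i _; rewrite mxE scalerA.
Qed.

Lemma orb_anticomm x y :
  (orb x)^t* *m orb y + orb y *m (orb x)^t* = (dot x y)%:M.
Proof.
have -> : (orb x)^t* = \sum_i Num.conj (x i 0) *: annihilation R i.
  by rewrite ctmx_sum; apply: eq_bigr => i _; rewrite ctmxZ.
rewrite mulmx_suml mulmx_sumr -big_split /= dotE.
rewrite raddf_sum; apply: eq_bigr => i _ /=.
rewrite -scalemxAl -scalemxAr -scalerDr mulmx_sumr mulmx_suml -big_split /=.
rewrite (bigD1 i) //= big1 => [|j ji]; last first.
  rewrite -scalemxAl -scalemxAr -scalerDr creation_anticomm.
  by rewrite eq_sym (negPf ji) raddf0 scaler0.
rewrite addr0 -scalemxAl -scalemxAr -scalerDr creation_anticomm eqxx.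
by rewrite scalerA -[_ *: _]/(_ *: _) scale_scalar_mx mulr1.
Qed.

Lemma orb_vacuum x : (orb x)^t* *m vacuum R m = 0.
Proof.
rewrite ctmx_sum mulmx_suml big1 // => i _.
rewrite ctmxZ -scalemxAl (_ : _ *m _ = 0) ?scaler0 //.
apply/matrixP => a b; rewrite !mxE big1 // => c _.
rewrite -/(annihilation R i) annihilationE creationE !mxE.
case: ifP => [/andP[_ /eqP ->]|]; last by rewrite mul0r.
case: eqP => [e|]; last by rewrite mulr0.
by have := finset.setU11 i (enum_val a); rewrite e inE.
Qed.

Lemma dot_vacuum : dot (vacuum R m) (vacuum R m) = 1.
Proof.
rewrite dotE (@sum_fock finset.set0) => [|a /negPf ne]; last first.
  by rewrite !mxE ne mulr0.
by rewrite !mxE enum_rankK eqxx rmorph1 mulr1.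
Qed.

Lemma nsq_orb x (phi : fock R m) :
  nsq (orb x *m phi) + nsq ((orb x)^t* *m phi) = nsq x * nsq phi.
Proof.
apply: complexI; rewrite rmorphD rmorphM /= -!dotvv.
rewrite !dot_adjl ctmxK !mulmxA -dotDr -mulmxDl orb_anticomm.
by rewrite mul_scalar_mx dotZr dotvv.
Qed.

Lemma nsq_orb_le x (phi : fock R m) : nsq (orb x *m phi) <= nsq x * nsq phi.
Proof. by rewrite -nsq_orb lerDl nsq_ge0. Qed.

Lemma nsq_orbA_le x (phi : fock R m) :
  nsq ((orb x)^t* *m phi) <= nsq x * nsq phi.
Proof. by rewrite -nsq_orb lerDr nsq_ge0. Qed.

Lemma slater0 (U : 'M[C]_(m, 0)) : slater U = vacuum R m.
Proof. by rewrite /slater big_ord0 mul1mx. Qed.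

Lemma slaterS n (U : 'M[C]_(m, n.+1)) :
  slater U = orb (col 0 U) *m slater (col' 0 U).
Proof.
rewrite /slater big_ord_recl -mulmxA.
have -> : orbital_creation U ord0 = orb (col 0 U).
  by apply: eq_bigr => j _; rewrite mxE.
congr (_ *m (_ *m _)); apply: eq_bigr => i _; apply: eq_bigr => j _.
by rewrite mxE.
Qed.

Lemma slater_lift n (Y : 'M[C]_(m, n.+2)) (i : 'I_n.+1) :
  slater (col' (lift 0 i) Y) = orb (col 0 Y) *m slater (col' i (col' 0 Y)).
Proof.
rewrite slaterS; congr (_ *m _); [congr orb|congr slater];
  apply/matrixP => a b; rewrite !mxE;
  congr (Y _ _); apply: val_inj => //=; rewrite /bump /=; lia.
Qed.

Lemma annihilate_slater n (Y : 'M[C]_(m, n)) x :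
  (orb x)^t* *m slater Y =
  \sum_(i < n) ((-1) ^+ i * dot x (col i Y)) *: slater (col' i Y).
Proof.
elim: n Y => [|n IH] Y.
  by rewrite big_ord0 slater0 orb_vacuum.
rewrite slaterS mulmxA.
rewrite (_ : (orb x)^t* *m orb _ =
   (dot x (col 0 Y))%:M - orb (col 0 Y) *m (orb x)^t*); last first.
  by rewrite -orb_anticomm addrK.
rewrite mulmxBl mul_scalar_mx -mulmxA IH big_ord_recl mul1r.
congr (_ + _); rewrite mulmx_sumr -sumrN; apply: eq_bigr => i _.
case: n Y i {IH} => [|n] Y i; first by case: i.
rewrite slater_lift -scalemxAr -scaleNr; congr (_ *: _).
rewrite exprS mulN1r mulNr; congr (- (_ * dot _ _)).
by apply/matrixP => a b; rewrite !mxE.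
Qed.

Lemma gram_slater n (X Y : 'M[C]_(m, n)) :
  dot (slater X) (slater Y) = \det (X^t* *m Y).
Proof.
elim: n X Y => [|n IH] X Y; first by rewrite !slater0 dot_vacuum det_mx00.
rewrite slaterS dot_adjl annihilate_slater dot_sumr (expand_det_row _ 0).
apply: eq_bigr => i _; rewrite dotZr IH /cofactor mulmx_dot add0n.
rewrite mulrA [_ * (-1) ^+ _]mulrC; congr (_ * \det _).
by apply/matrixP => a b; rewrite !mxE; apply: eq_bigr => k _; rewrite !mxE.
Qed.

(* By the Gram formula the difference of both sides is orthogonal to each of
   them, hence to itself. *)
Lemma slater_mul n (Y : 'M[C]_(m, n)) (T : 'M[C]_n) :
  slater (Y *m T) = \det T *: slater Y.
Proof.
apply/eqP; rewrite -subr_eq0; apply/eqP/nsq_eq0/complexI; rewrite -dotvv.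
rewrite dotBl !dotBr !dotZl !dotZr !gram_slater ctmxM -!mulmxA.
rewrite [Y^t* *m (Y *m T)]mulmxA !det_mulmx.
have -> : \det (T^t*) = Num.conj (\det T) by rewrite det_map_mx det_tr.
by rewrite [\det (Y^t* *m Y)]lock; ring.
Qed.

End Fock.

(** * Amplitudes *)

Section Amplitude.
Variable R : realType.
Local Notation C := R[i].

Definition setcol m n (k : 'I_n) (x : 'cV[C]_m) (X : 'M[C]_(m, n)) :=
  \matrix_(i, j) (if j == k then x i 0 else X i j).

Lemma col_setcol m n (k : 'I_n) x (X : 'M[C]_(m, n)) j :
  col j (setcol k x X) = if j == k then x else col j X.
Proof.
by apply/matrixP => a b; rewrite !mxE; case: eqP => _; rewrite ?mxE ?ord1.
Qed.

Lemma col'_setcol m n (k : 'I_n) x (X : 'M[C]_(m, n)) :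
  col' k (setcol k x X) = col' k X.
Proof. by apply/matrixP => a b; rewrite !mxE eq_sym (negPf (neq_lift _ _)). Qed.

Lemma setcol_id m n (k : 'I_n) (X : 'M[C]_(m, n)) : setcol k (col k X) X = X.
Proof. by apply/matrixP => a b; rewrite !mxE; case: eqP => [->|]. Qed.

Lemma slater_col m n (k : 'I_n) : exists2 e : C, csq e = 1 &
  forall X : 'M[C]_(m, n),
    slater X = e *: (orb (col k X) *m slater (col' k X)).
Proof.
case: n k => [[]//|n] k.
pose s := (lift_perm ord0 k 1)%g : 'S_n.+1.
exists (\det (perm_mx s)) => [|X].
  by rewrite det_perm; case: (s : bool); rewrite ?expr1 ?csqN csq1.
rewrite -[X in LHS]mulmx1 -(perm_mx1 _ n.+1) -(mulVg s) perm_mxM mulmxA.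
rewrite slater_mul -col_permE slaterS; congr (_ *: (_ *m _)).
  by congr orb; apply/matrixP => a b; rewrite !mxE lift_perm_id.
congr slater; apply/matrixP => a b; rewrite !mxE lift_perm_lift perm1.
by [].
Qed.

Lemma nsq_slater_le1 m n (X : 'M[C]_(m, n)) :
  (forall j, nsq (col j X) <= 1) -> nsq (slater X) <= 1.
Proof.
elim: n X => [|n IH] X h.
  by rewrite slater0 /nsq dot_vacuum.
rewrite slaterS (le_trans (nsq_orb_le _ _)) //.
rewrite -[leRHS]mulr1 ler_pM ?nsq_ge0 //; apply: IH => j.
suff -> : col j (col' 0 X) = col (lift 0 j) X by [].
by apply/matrixP => a b; rewrite !mxE.
Qed.

(* Hadamard's inequality: the Slater vector of [T] has norm [|\det T|]. *)
Lemma csq_det_le1 n (T : 'M[C]_n) :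
  (forall j, nsq (col j T) <= 1) -> csq (\det T) <= 1.
Proof.
move=> /nsq_slater_le1; suff -> : nsq (slater T) = csq (\det T) by [].
apply: complexI; rewrite -dotvv gram_slater det_mulmx csqE.
by rewrite det_map_mx det_tr.
Qed.

Lemma nsq_isometric m n (U : 'M[C]_(m, n)) x :
  isometric U -> nsq (U *m x) = nsq x.
Proof. by move=> hU; rewrite /nsq dot_adjl mulmxA hU mul1mx. Qed.

Lemma bessel_id m r (V : 'M[C]_(m, r)) y : isometric V ->
  nsq (V^t* *m y) + nsq (y - V *m (V^t* *m y)) = nsq y.
Proof.
move=> hV; apply: complexI; rewrite rmorphD /= -!dotvv dotBl !dotBr.
set z := V^t* *m y; rewrite (dot_adjr V y) -/z (dot_adjl V z y) -/z.
by rewrite (dot_adjl V z) mulmxA hV mul1mx; ring.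
Qed.

Lemma bessel m r (V : 'M[C]_(m, r)) y : isometric V ->
  nsq (V^t* *m y) <= nsq y.
Proof. by move=> hV; rewrite -(bessel_id y hV) lerDl nsq_ge0. Qed.

Lemma replace_columns m n (g : 'M[C]_(m, n) -> R) (U W : 'M[C]_(m, n)) (kappa : R) :
  (forall j, nsq (col j U) <= 1) -> (forall j, nsq (col j W) <= 1) ->
  (forall k X, (forall j, nsq (col j X) <= 1) -> col k X = col k U ->
     g X <= g (setcol k (col k W) X) + kappa) ->
  g U <= g W + n%:R * kappa.
Proof.
move=> hU hW hstep.
pose mix k : 'M[C]_(m, n) := \matrix_(i, j) if (j < k)%N then W i j else U i j.
have col_mix k j : col j (mix k) = if (j < k)%N then col j W else col j U.
  by apply/matrixP => a b; rewrite !mxE; case: ifP; rewrite mxE.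
have h k : (k <= n)%N -> g U <= g (mix k) + k%:R * kappa.
  elim: k => [_|k IH kn].
    rewrite mul0r addr0 (_ : mix 0 = U) //.
    by apply/matrixP => i j; rewrite mxE.
  apply: le_trans (IH (ltnW kn)) _.
  rewrite -natr1 mulrDl mul1r [_ * _ + _]addrC addrA lerD2r.
  have -> : mix k.+1 = setcol (Ordinal kn) (col (Ordinal kn) W) (mix k).
    apply/matrixP => i j; rewrite !mxE ltnS leq_eqVlt -val_eqE /=.
    by case: eqP => //= e; congr (W _ _); apply: val_inj.
  apply: hstep => [j|]; rewrite col_mix; last by rewrite ltnn.
  by case: ifP.
have := h n (leqnn n); rewrite (_ : mix n = W) //.
by apply/matrixP => i j; rewrite mxE ltn_ord.
Qed.

Variables (m n : nat) (psi : fock R m).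
Hypothesis psi1 : normalized psi.

Lemma nsq_psi : nsq psi = 1.
Proof. by rewrite /nsq /dot psi1 mxE. Qed.

Local Notation f := (amplitude psi).

Lemma amplitudeE k (U : 'M[C]_(m, k)) : f U = dot (slater U) psi.
Proof. by []. Qed.

Lemma fidelityE k (U : 'M[C]_(m, k)) :
  fidelity (pure_state psi) (slater U) = csq (f U).
Proof.
rewrite /fidelity /pure_state (mulmxA _ psi) mx11_dot -mulmxA mul_scalar_mx mxE.
rewrite -/(dot psi _) -(dot_conj (slater U)) amplitudeE.
by case: (dot _ _) => a b; rewrite /csq /=; ring.
Qed.

Lemma amplitude_col (k : 'I_n) : exists2 e : C, csq e = 1 &
  forall X : 'M[C]_(m, n),
    f X = e * dot (slater (col' k X)) ((orb (col k X))^t* *m psi).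
Proof.
have [e e1 h] := @slater_col m n k; exists (Num.conj e) => [|X].
  by rewrite csq_conj.
by rewrite amplitudeE h dotZl dot_adjl.
Qed.

Lemma amplitude_linear (k : 'I_n) (a : R) x y (X : 'M[C]_(m, n)) :
  col k X = a%:C *: x + y ->
  f X = a%:C * f (setcol k x X) + f (setcol k y X).
Proof.
have [e _ h] := amplitude_col k => hc; rewrite !h !col'_setcol !col_setcol eqxx.
rewrite hc orbD orbZ ctmxD ctmxZ.
rewrite -[Num.conj a%:C]/(a%:C^*%C) conjc_real mulmxDl dotDr -scalemxAl dotZr.
by rewrite mulrDr mulrCA.
Qed.

Lemma amplitude_col_le (k : 'I_n) (X : 'M[C]_(m, n)) :
  (forall j, j != k -> nsq (col j X) <= 1) ->
  csq (f X) <= nsq ((orb (col k X))^t* *m psi).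
Proof.
move=> hX; have [e e1 ->] := amplitude_col k.
rewrite csqM e1 mul1r (le_trans (cauchy_schwarz _ _)) //.
rewrite -[leRHS]mul1r ler_wpM2r ?nsq_ge0 // nsq_slater_le1 // => j.
have -> : col j (col' k X) = col (lift k j) X.
  by apply/matrixP => a b; rewrite !mxE.
by apply: hX; rewrite eq_sym neq_lift.
Qed.

Lemma nsq_annihilate_le x : nsq ((orb x)^t* *m psi) <= nsq x.
Proof. by have := nsq_orbA_le x psi; rewrite nsq_psi mulr1. Qed.

Lemma amplitude_zero_col (k : 'I_n) (X : 'M[C]_(m, n)) :
  col k X = 0 -> f X = 0.
Proof.
have [e _ ->] := amplitude_col k; move=> ->.
rewrite /orb (eq_bigr (fun _ => 0)) => [|i _]; last by rewrite mxE scale0r.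
by rewrite sumr_const mul0rn ctmx0 mul0mx dot0r mulr0.
Qed.

Lemma amplitude_isometric_ge (A Y : 'M[C]_(m, n)) (T : 'M[C]_n) :
  isometric A -> Y = A *m T -> (forall j, nsq (col j Y) <= 1) ->
  csq (f Y) <= csq (f A).
Proof.
move=> hA -> hY; rewrite !amplitudeE slater_mul dotZl csqM csq_conj.
rewrite -[leRHS]mul1r ler_wpM2r ?csq_ge0 //; apply: csq_det_le1 => j.
by rewrite -(nsq_isometric _ hA) colE mulmxA -colE hY.
Qed.

Lemma amplitude_factor_zero (A Y : 'M[C]_(m, n)) (T : 'M[C]_n) k :
  col k A = 0 -> Y = A *m T -> f Y = 0.
Proof.
move=> hk ->; rewrite amplitudeE slater_mul dotZl -amplitudeE.
by rewrite (amplitude_zero_col hk) mulr0.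
Qed.

Lemma csq_mix_le (c : R) (s2 kappa : R) (z1 z2 : C) :
  0 <= s2 -> c ^+ 2 + s2 <= 1 -> 0 <= kappa -> csq z2 <= kappa * s2 ->
  csq (c%:C * z1 + z2) <= csq z1 + kappa.
Proof.
move=> s0 cs k0 h2.
have [e|ne] := eqVneq s2 0.
  have z20 : z2 = 0.
    apply: csq_eq0; apply/eqP; rewrite eq_le csq_ge0 andbT.
    by move: h2; rewrite e mulr0.
  rewrite z20 addr0 csqM csqR.
  have := csq_ge0 z1; move: (csq z1) => t t0; rewrite e in cs; nra.
have sp : 0 < s2 by rewrite lt_def ne.
have young : s2 * csq (c%:C * z1 + z2) <= (c ^+ 2 + s2) * (s2 * csq z1 + csq z2).
  case: z1 z2 {h2} => [a b] [p q]; rewrite /csq /=.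
  rewrite -subr_ge0; have -> : (c ^+ 2 + s2) * (s2 * (a ^+ 2 + b ^+ 2) + (p ^+ 2 + q ^+ 2)) -
     s2 * ((c * a - 0 * b + p) ^+ 2 + (c * b + 0 * a + q) ^+ 2) =
     (s2 * a - c * p) ^+ 2 + (s2 * b - c * q) ^+ 2 by ring.
  by rewrite addr_ge0 ?sqr_ge0.
rewrite -(ler_pM2l sp); apply: (le_trans young).
have := csq_ge0 z1; have := csq_ge0 z2; move: (csq z1) (csq z2) h2 => t1 t2 *.
have : (c ^+ 2 + s2) * (s2 * t1 + t2) <= 1 * (s2 * t1 + t2).
  by rewrite ler_wpM2r // addr_ge0 // mulr_ge0.
by nra.
Qed.

(* One column at a time: a column is [c *: x + q] with [x] a unit vector of the
   range of [V], [q] orthogonal to it and [c ^ 2 + nsq q <= 1].  By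
   Cauchy-Schwarz, replacing it by [x] costs at most [kappa]. *)
Lemma truncate_columns r (V : 'M[C]_(m, r)) (kappa : R) (U : 'M[C]_(m, n)) :
  isometric V -> 0 <= kappa ->
  (forall x, V^t* *m x = 0 -> nsq ((orb x)^t* *m psi) <= kappa * nsq x) ->
  (forall j, nsq (col j U) <= 1) ->
  exists2 Z : 'M[C]_(r, n), (forall j, nsq (col j Z) <= 1) &
    csq (f U) <= csq (f (V *m Z)) + n%:R * kappa.
Proof.
move=> hV k0 hk hU.
pose c j : R := Num.sqrt (nsq (V^t* *m col j U)).
have c2 j : c j ^+ 2 = nsq (V^t* *m col j U) by rewrite sqr_sqrtr ?nsq_ge0.
pose z j := ((c j)^-1)%:C *: (V^t* *m col j U).
have zle j : nsq (z j) <= 1.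
  rewrite nsqZ csqR -c2; have [->|nz] := eqVneq (c j) 0.
    by rewrite expr0n mulr0.
  by rewrite exprVn mulVf // expf_neq0.
have zE j : (c j)%:C *: z j = V^t* *m col j U.
  rewrite scalerA -rmorphM; have [e|nz] := eqVneq (c j) 0; last first.
    by rewrite mulfV // scale1r.
  rewrite e mul0r scale0r; apply/esym/nsq_eq0.
  by rewrite -c2 e expr0n.
pose Z : 'M[C]_(r, n) := \matrix_(i, j) z j i 0.
have colZ j : col j Z = z j by apply/matrixP => a b; rewrite !mxE ord1.
have colVZ j : col j (V *m Z) = V *m z j by rewrite -colZ !colE mulmxA.
exists Z => [j|]; first by rewrite colZ.
apply: (replace_columns (g := fun X => csq (f X))) => // [j|k X hX ek].
  by rewrite colVZ nsq_isometric.
rewrite colVZ; set u := col k U in ek *.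
rewrite (@amplitude_linear k (c k) (V *m z k) (u - V *m (V^t* *m u))); last first.
  by rewrite ek -zE (scalemxAr (c k)%:C V (z k)) addrCA subrr addr0.
set q := u - _.
have hq : c k ^+ 2 + nsq q <= 1 by rewrite c2 bessel_id.
apply: csq_mix_le hq _ _ => //; first exact: nsq_ge0.
apply: le_trans (amplitude_col_le (k := k) _) _ => [j jk|].
  by rewrite col_setcol (negPf jk).
rewrite col_setcol eqxx; apply: hk.
by rewrite mulmxBr mulmxA hV mul1mx subrr.
Qed.

Lemma csq_close (e : R) (z1 z2 : C) :
  0 <= e -> csq (z1 + z2) <= 1 -> csq z1 <= 1 -> csq z2 <= e ^+ 2 ->
  csq (z1 + z2) <= csq z1 + 2 * e.
Proof.
have aux (a b p q : R) : 0 <= e -> a ^+ 2 + b ^+ 2 <= 1 ->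
    p ^+ 2 + q ^+ 2 <= e ^+ 2 -> a * p + b * q <= e.
  move=> e0 h1 h2; apply: le_trans (ler_norm _) _.
  rewrite -(ler_pXn2r (n := 2)) ?nnegrE // real_normK ?num_real //.
  have -> : (a * p + b * q) ^+ 2 = (a ^+ 2 + b ^+ 2) * (p ^+ 2 + q ^+ 2)
     - (a * q - b * p) ^+ 2 by ring.
  have := sqr_ge0 (a * q - b * p).
  have := sqr_ge0 a; have := sqr_ge0 b; have := sqr_ge0 p; have := sqr_ge0 q.
  move: (a ^+ 2) (b ^+ 2) (p ^+ 2) (q ^+ 2) ((_ - _) ^+ 2) (e ^+ 2) h1 h2.
  move=> *; nra.
case: z1 z2 => [a b] [p q]; rewrite /csq /= => e0 h1 h2 h3.
have := aux _ _ _ _ e0 h1 h3; have := aux _ _ _ _ e0 h2 h3; lra.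
Qed.

Lemma round_columns (U W : 'M[C]_(m, n)) (e : R) : 0 <= e ->
  (forall j, nsq (col j U) <= 1) -> (forall j, nsq (col j W) <= 1) ->
  (forall j, nsq (col j U - col j W) <= e ^+ 2) ->
  csq (f U) <= csq (f W) + n%:R * (2 * e).
Proof.
move=> e0 hU hW hUW; apply: (replace_columns (g := fun X => csq (f X))) => // k X hX ek.
have hlin := @amplitude_linear k 1 (col k W) (col k U - col k W) X.
rewrite scale1r mul1r in hlin; rewrite hlin; last by rewrite ek addrC subrK.
have bnd x Y : (forall j, nsq (col j Y) <= 1) ->
    csq (f (setcol k x Y)) <= nsq x.
  move=> hY; apply: le_trans (amplitude_col_le (k := k) _) _ => [j jk|].
    by rewrite col_setcol (negPf jk).
  by rewrite col_setcol eqxx nsq_annihilate_le.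
apply: csq_close => //.
- rewrite -hlin; last by rewrite ek addrC subrK.
  by rewrite -(setcol_id k X) (le_trans (bnd _ _ hX)).
- by rewrite (le_trans (bnd _ _ hX)).
- by rewrite (le_trans (bnd _ _ hX)).
Qed.

End Amplitude.

(** * The one-particle density matrix *)

Section Density.
Variable R : realType.
Local Notation C := R[i].

Lemma ReD (x y : C) : complex.Re (x + y) = complex.Re x + complex.Re y.
Proof. by case: x; case: y. Qed.
Lemma ReB (x y : C) : complex.Re (x - y) = complex.Re x - complex.Re y.
Proof. by case: x; case: y. Qed.
Lemma ReZ (a : R) (y : C) : complex.Re (a%:C * y) = a * complex.Re y.
Proof. by case: y => c d /=; rewrite mul0r subr0. Qed.
Lemma Re_conj (y : C) : complex.Re (Num.conj y) = complex.Re y.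
Proof. by case: y. Qed.

Definition qform N (A : 'M[C]_N) (x : 'cV[C]_N) : R :=
  complex.Re (dot x (A *m x)).

Lemma qformB N (A B : 'M[C]_N) x : qform (A - B) x = qform A x - qform B x.
Proof. by rewrite /qform mulmxBl dotBr ReB. Qed.

Lemma qform1 N (x : 'cV[C]_N) : qform 1%:M x = nsq x.
Proof. by rewrite /qform mul1mx. Qed.

Lemma qform_shift N (a b : R) (A : 'M[C]_N) x :
  qform (a%:C *: 1%:M - b%:C *: (A + A^t*)) x = a * nsq x - 2 * b * qform A x.
Proof.
rewrite /qform mulmxBl dotBr ReB -(scalemxAl a%:C) -(scalemxAl b%:C).
rewrite !dotZr !ReZ mul1mx mulmxDl dotDr ReD (dot_adjr (A^t*)) ctmxK.
by rewrite -(dot_conj x (A *m x)) Re_conj mulrDr -mulrA mulr_natl mulr2n.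
Qed.

Lemma shift_herm N (a b : R) (A : 'M[C]_N) :
  (a%:C *: 1%:M - b%:C *: (A + A^t*))^t* = a%:C *: 1%:M - b%:C *: (A + A^t*).
Proof.
rewrite ctmxB (ctmxZ a%:C) (ctmxZ b%:C) ctmxD ctmxK ctmx1 [A + _]addrC.
by rewrite -[Num.conj a%:C]/(a%:C^*%C) -[Num.conj b%:C]/(b%:C^*%C) !conjc_real.
Qed.

Lemma nsq_mulmx_le N (A : 'M[C]_N) x :
  nsq (A *m x) <= (\sum_i nsq (col i (A^t*))) * nsq x.
Proof.
rewrite nsqE mulr_suml; apply: ler_sum => i _.
suff -> : (A *m x) i 0 = dot (col i (A^t*)) x by apply: cauchy_schwarz.
rewrite mxE dotE; apply: eq_bigr => k _.
by rewrite mxE ctmxE conjCK.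
Qed.

Lemma opnorm_ubound N (A : 'M[C]_N) :
  has_ubound [set vnorm (A *m v) | v in [set v : 'cV[C]_N | vnorm v = 1]]%classic.
Proof.
exists (Num.sqrt (\sum_i nsq (col i (A^t*)))) => _ [v /= v1 <-].
rewrite /vnorm -/(dot (A *m v) _) -/(nsq (A *m v)) ler_wsqrtr //.
have nv : nsq v = 1.
  by have := sqr_sqrtr (nsq_ge0 v); rewrite [Num.sqrt _]v1 expr1n.
by have := nsq_mulmx_le A v; rewrite nv mulr1.
Qed.

Lemma opnorm_ge0 N (A : 'M[C]_N) : 0 <= opnorm A.
Proof.
rewrite /opnorm; set S := (X in sup X).
have [[y Sy]|/nonemptyPn ->] := pselect (S !=set0)%classic; last by rewrite sup0.
have := ub_le_sup (opnorm_ubound A) Sy; apply: le_trans.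
by case: Sy => v _ <-; apply: sqrtr_ge0.
Qed.

Lemma opnorm_bound N (A : 'M[C]_N) x :
  nsq (A *m x) <= opnorm A ^+ 2 * nsq x.
Proof.
have [/nsq_eq0 ->|nz] := eqVneq (nsq x) 0.
  by rewrite mulmx0 !nsq0 mulr0.
pose u := ((Num.sqrt (nsq x))^-1)%:C *: x.
have sx0 : 0 < Num.sqrt (nsq x) by rewrite sqrtr_gt0 lt_def nz nsq_ge0.
have nu : nsq u = 1.
  by rewrite nsqZ csqR exprVn sqr_sqrtr ?nsq_ge0 // mulVf.
have h : vnorm (A *m u) <= opnorm A.
  apply: (ub_le_sup (opnorm_ubound A)); exists u => //=.
  by rewrite /vnorm -/(dot u u) -/(nsq u) nu sqrtr1.
have ex : x = (Num.sqrt (nsq x))%:C *: u.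
  by rewrite scalerA -rmorphM mulfV ?gt_eqF // scale1r.
rewrite ex; move: (Num.sqrt _) => c in ex *; clearbody u.
rewrite -scalemxAr !nsqZ mulrCA ler_wpM2l ?csq_ge0 // nu mulr1.
have -> : nsq (A *m u) = vnorm (A *m u) ^+ 2 by rewrite sqr_sqrtr ?nsq_ge0.
by rewrite lerXn2r // ?nnegrE ?sqrtr_ge0 // opnorm_ge0.
Qed.

Lemma qform_opnorm N (A : 'M[C]_N) (c : R) x :
  opnorm A <= c -> 0 <= c -> `|qform A x| <= c * nsq x.
Proof.
move=> hA c0.
have op0 : 0 <= opnorm A.
  exact: opnorm_ge0.
have h1 : csq (dot x (A *m x)) <= (c * nsq x) ^+ 2.
  apply: le_trans (cauchy_schwarz _ _) _.
  rewrite exprMn [leRHS]mulrC expr2 -mulrA ler_wpM2l ?nsq_ge0 //.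
  rewrite mulrC (le_trans (opnorm_bound _ _)) // ler_wpM2r ?nsq_ge0 //.
  by rewrite lerXn2r // nnegrE.
rewrite -(ler_pXn2r (n := 2)) ?nnegrE ?mulr_ge0 ?nsq_ge0 //.
rewrite real_normK ?num_real // (le_trans _ h1) // /csq lerDl sqr_ge0.
by [].
Qed.

Variables (m n : nat) (psi : fock R m).
Hypothesis psi1 : normalized psi.
Hypothesis psin : n_particle n psi.

Lemma rdm1E i j : rdm1 (pure_state psi) i j =
  dot (annihilation R j *m psi) (annihilation R i *m psi).
Proof.
rewrite mxE /pure_state mulmxA mxtrace_mulC mulmxA /mxtrace big_ord1.
by rewrite dot_adjl ctmxK [in RHS]/dot !mulmxA.
Qed.

Lemma orb_adj_mul (x : 'cV[C]_m) :
  (orb x)^t* *m psi = \sum_i Num.conj (x i 0) *: (annihilation R i *m psi).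
Proof.
rewrite ctmx_sum mulmx_suml; apply: eq_bigr => i _.
by rewrite ctmxZ -scalemxAl.
Qed.

Lemma qform_rdm1 x : qform (rdm1 (pure_state psi)) x = nsq ((orb x)^t* *m psi).
Proof.
congr complex.Re; rewrite dotE orb_adj_mul dot_sumr.
under eq_bigr do rewrite mxE mulr_sumr.
apply: eq_bigr => i _; rewrite dotZr.
have -> : forall v : fock R m,
  dot (\sum_j Num.conj (x j 0) *: (annihilation R j *m psi)) v =
  \sum_j x j 0 * dot (annihilation R j *m psi) v.
  move=> v; rewrite -dot_conj dot_sumr rmorph_sum; apply: eq_bigr => j _ /=.
  by rewrite dotZr rmorphM /= conjCK dot_conj.
rewrite mulr_sumr; apply: eq_bigr => j _.
by rewrite rdm1E; ring.
Qed.

Lemma number_op k a b : (creation R k *m annihilation R k) a b =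
  ((a == b) && (k \in (enum_val a : {set 'I_m})))%:R.
Proof.
rewrite mxE; set A : {set 'I_m} := enum_val a; set B : {set 'I_m} := enum_val b.
rewrite (@sum_fock _ _ (A :\ k)) => [|c cA]; last first.
  rewrite creationE; case: ifP => [/andP[kc /eqP e]|]; last by rewrite mul0r.
  by case/eqP: cA; rewrite /A e finset.setU1K.
rewrite annihilationE !creationE !enum_rankK -/A -/B finset.setD11 /=.
have -> : (a == b) = (A == B) by rewrite /A /B (inj_eq enum_val_inj).
clearbody A B; case: (boolP (k \in A)) => kA.
  rewrite finset.setD1K // eqxx andbT eq_sym; case: eqP => _; rewrite ?mulr0 //.
  exact: jwsq.
rewrite andbF; case: eqP => [e|_]; last by rewrite mul0r.
by move: kA; rewrite e finset.setU11.
Qed.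

Lemma sum_nsq_annihilation : \sum_k nsq (annihilation R k *m psi) = n%:R.
Proof.
have e k : nsq (annihilation R k *m psi) =
    \sum_a (k \in (enum_val a : {set 'I_m}))%:R * csq (psi a 0).
  rewrite /nsq dot_adjl ctmxK mulmxA dotE Re_sum; apply: eq_bigr => a _.
  rewrite mxE (bigD1 a) //= number_op eqxx big1 ?addr0 => [|b ba]; last first.
    by rewrite number_op eq_sym (negPf ba) mul0r.
  by case: (k \in _); rewrite /= ?mul1r ?mul0r ?mulr0 // -csqE.
rewrite (eq_bigr _ (fun k _ => e k)) exchange_big /=.
rewrite (eq_bigr (fun a => n%:R * csq (psi a 0))) => [|a _]; last first.
  rewrite -mulr_suml -natr_sum -big_mkcond /= sum1_card.
  have [->//|ne] := eqVneq #|(enum_val a : {set 'I_m})| n.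
  by rewrite psin // csq0 !mulr0.
by rewrite -mulr_sumr -nsqE nsq_psi // mulr1.
Qed.

Lemma sum_nsq_orb r (V : 'M[C]_(m, r)) : isometric V ->
  \sum_i nsq ((orb (col i V))^t* *m psi) <= n%:R.
Proof.
move=> hV; rewrite -sum_nsq_annihilation.
pose ph a : 'cV[C]_m := \col_k (annihilation R k *m psi) a 0.
have e1 : \sum_k nsq (annihilation R k *m psi) = \sum_a nsq (ph a).
  rewrite (eq_bigr _ (fun k _ => nsqE (annihilation R k *m psi))).
  rewrite exchange_big; apply: eq_bigr => a _ /=.
  by rewrite nsqE; apply: eq_bigr => k _; rewrite [ph a k 0]mxE.
have e2 : \sum_i nsq ((orb (col i V))^t* *m psi) = \sum_a nsq (V^t* *m ph a).
  rewrite (eq_bigr _ (fun i _ => nsqE ((orb (col i V))^t* *m psi))).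
  rewrite exchange_big; apply: eq_bigr => a _ /=.
  rewrite nsqE; apply: eq_bigr => i _; congr csq.
  rewrite orb_adj_mul summxE mxE; apply: eq_bigr => k _.
  by rewrite mxE ctmxE !mxE.
by rewrite e1 e2; apply: ler_sum => a _; apply: bessel.
Qed.

Variables (eps : R) (gh : 'M[C]_m).
Hypothesis n0 : (0 < n)%N.
Hypothesis eps0 : 0 < eps.
Hypothesis hgh : opnorm (gh - rdm1 (pure_state psi)) < eps / (8 * n%:R).

(* Up to the factor [8 n], the form [3 eps / (8 n) - gh] for the hermitian part
   of [gh]: its sign separates occupations below [eps / (2 n)] from those above
   [eps / (4 n)]. *)
Definition gap_form : 'M[C]_m :=
  (3 * eps)%:C *: 1%:M - (4 * n%:R)%:C *: (gh + gh^t*).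

Lemma gap_formE x :
  qform gap_form x = 3 * eps * nsq x - 8 * n%:R * qform gh x.
Proof. by rewrite qform_shift; ring. Qed.

Lemma gap_form_herm : gap_form^t* = gap_form.
Proof. exact: shift_herm. Qed.

Let n8 : 0 < 8 * n%:R :> R. Proof. by rewrite mulr_gt0 // ltr0n. Qed.

Lemma estimate_gap x :
  `|8 * n%:R * qform gh x - 8 * n%:R * nsq ((orb x)^t* *m psi)| <= eps * nsq x.
Proof.
rewrite -mulrBr -qform_rdm1 -qformB normrM (gtr0_norm n8).
have h := qform_opnorm x (ltW hgh) (ltW (divr_gt0 eps0 n8)).
apply: le_trans (ler_wpM2l (ltW n8) h) _.
by rewrite mulrA mulrCA mulfV ?gt_eqF // mulr1.
Qed.

Lemma gap_nonneg x : 0 <= qform gap_form x ->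
  nsq ((orb x)^t* *m psi) <= eps / (2 * n%:R) * nsq x.
Proof.
rewrite gap_formE => h; have := estimate_gap x; rewrite ler_norml => /andP[h1 _].
have n1 : 0 < 2 * n%:R :> R by rewrite mulr_gt0 // ltr0n.
rewrite mulrAC ler_pdivlMr //.
move: (nsq _) (nsq x) (qform gh x) h h1 => a b c; lra.
Qed.

Lemma gap_nonpos x : qform gap_form x <= 0 -> nsq x = 1 ->
  eps <= 4 * n%:R * nsq ((orb x)^t* *m psi).
Proof.
rewrite gap_formE => h e; have := estimate_gap x.
rewrite e ler_norml => /andP[_ h1]; rewrite e in h.
by move: (nsq _) (qform gh x) h h1 => a c; lra.
Qed.

Lemma rank_bound r (V : 'M[C]_(m, r)) : isometric V ->
  (forall j, qform gap_form (col j V) <= 0) -> r%:R * eps <= 4 * n%:R ^+ 2.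
Proof.
move=> hV hq; have := sum_nsq_orb hV.
have h j : eps / (4 * n%:R) <= nsq ((orb (col j V))^t* *m psi).
  rewrite ler_pdivrMr ?mulr_gt0 ?ltr0n // mulrC; apply: gap_nonpos => //.
  by rewrite /nsq -mulmx_dot hV mxE eqxx.
move=> hs; have : r%:R * (eps / (4 * n%:R)) <= n%:R.
  apply: le_trans hs; rewrite mulr_natl -[X in _ *+ X]card_ord -sumr_const.
  exact: ler_sum.
rewrite mulrA ler_pdivrMr ?mulr_gt0 ?ltr0n // => h2.
by apply: le_trans h2 _; rewrite expr2; lra.
Qed.

Definition gridc (L p q : nat) : C :=
  ((p%:R - L%:R) / L%:R) +i* ((q%:R - L%:R) / L%:R).

Lemma round_toward0 (L : nat) (x : R) : (0 < L)%N -> `|x| <= 1 ->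
  exists p, [/\ (p < L.*2.+1)%N, ((p%:R - L%:R) / L%:R) ^+ 2 <= x ^+ 2 &
     (x - (p%:R - L%:R) / L%:R) ^+ 2 <= L%:R ^- 2].
Proof.
move=> L0; have LR : 0 < L%:R :> R by rewrite ltr0n.
wlog x0 : x / 0 <= x => [h|] hx.
  have [/h|/ltW x0] := leP 0 x; first exact.
  have [||p [hp h1 h2]] := h (- x); rewrite ?oppr_ge0 ?normrN //.
  exists (L.*2 - p)%N; split; first lia.
    have -> : (L.*2 - p)%:R - L%:R = - (p%:R - L%:R) :> R.
      by rewrite natrB -?addnn ?natrD; [ring|lia].
    by rewrite mulNr sqrrN -(sqrrN x).
  have -> : (L.*2 - p)%:R - L%:R = - (p%:R - L%:R) :> R.
    by rewrite natrB -?addnn ?natrD; [ring|lia].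
  rewrite mulNr; move: h2; set t := (_ / _).
  by rewrite -(sqrrN (x - _)) !opprD !opprK.
have /truncn_itv /andP[t1 t2] : 0 <= L%:R * x by rewrite mulr_ge0 // ltW.
set t := Num.trunc _ in t1 t2; exists (L + t)%N.
have -> : ((L + t)%:R - L%:R) / L%:R = t%:R / L%:R :> R.
  by rewrite natrD addrC addrA addNr add0r.
have tx : t%:R / L%:R <= x by rewrite ler_pdivrMr // mulrC.
have xt : x - t%:R / L%:R <= L%:R^-1.
  rewrite lerBlDr -[X in X + _]mul1r -mulrDl ler_pdivlMr // mulrC.
  by rewrite addrC natr1 ltW.
split.
- rewrite -addnn ltnS leq_add2l -(ler_nat R) (le_trans t1) //.
  rewrite -[leRHS]mulr1 ler_wpM2l ?(ltW LR) // (le_trans _ hx) //.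
  exact: ler_norm.
- by rewrite lerXn2r ?nnegrE // divr_ge0 ?ler0n.
- rewrite -exprVn lerXn2r ?nnegrE ?subr_ge0 // invr_ge0; exact: ltW.
Qed.

Lemma csq_le_nsq N (z : 'cV[C]_N) i : csq (z i 0) <= nsq z.
Proof.
rewrite nsqE (bigD1 i) //= lerDl sumr_ge0 // => j _; exact: csq_ge0.
Qed.

Lemma le_halves (a b c d e x : R) :
  a <= b + e / 2 -> b <= c + d -> c <= x -> d <= e / 2 -> a <= x + e.
Proof. lra. Qed.

Lemma search_suffices r (V : 'M[C]_(m, r)) (L : nat) (b : R) :
  (n <= m)%N -> isometric V -> (0 < L)%N -> 8 * n%:R * r%:R <= L%:R * eps ->
  (forall x, V^t* *m x = 0 -> 0 <= qform gap_form x) ->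
  (forall X : 'M[C]_(r, n),
     (forall i j, exists p q, [/\ (p < L.*2.+1)%N, (q < L.*2.+1)%N &
        X i j = gridc L p q]) ->
     (forall j, nsq (col j X) <= 1) ->
     csq (amplitude psi (V *m X)) <= b) ->
  b >= OPT n (pure_state psi) - eps.
Proof.
move=> nm hV L0 hL hgap hb; rewrite lerBlDr.
have LR : 0 < L%:R :> R by rewrite ltr0n.
apply: ge_sup => [|_ [_ [U /= hU <-] <-]].
  pose U0 : 'M[C]_(m, n) := \matrix_(i, j) (i == widen_ord nm j)%:R.
  eexists; exists (slater U0) => //; exists U0 => //=.
  apply/matrixP => i j; rewrite mulmx_dot dotE (bigD1 (widen_ord nm i)) //=.
  rewrite !mxE eqxx rmorph1 mul1r big1 ?addr0 => [|k ki]; last first.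
    by rewrite !mxE (negPf ki) rmorph0 mul0r.
  by rewrite -val_eqE /= val_eqE.
rewrite fidelityE.
have nR : 0 < n%:R :> R by rewrite ltr0n.
have k0 : 0 <= eps / (2 * n%:R) by rewrite divr_ge0 ?mulr_ge0 ?ltW.
have hU1 j : nsq (col j U) <= 1 by rewrite /nsq -mulmx_dot hU mxE eqxx.
have [Z hZ h1] := truncate_columns hV k0
  (fun x hx => gap_nonneg (hgap x hx)) hU1.
have hround i j : {pq : nat * nat |
   [/\ (pq.1 < L.*2.+1)%N, (pq.2 < L.*2.+1)%N,
       csq (gridc L pq.1 pq.2) <= csq (Z i j) &
       csq (Z i j - gridc L pq.1 pq.2) <= 2 * L%:R ^- 2]}.
  apply: cid; have : csq (Z i j) <= 1.
    by have := csq_le_nsq (col j Z) i; rewrite mxE => /le_trans; apply.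
  case: (Z i j) => x y; rewrite /csq /= => hxy.
  have [|p [p1 p2 p3]] := @round_toward0 L x L0.
    rewrite -(expr_le1 (n := 2)) // real_normK ?num_real //.
    by apply: le_trans hxy; rewrite lerDl sqr_ge0.
  have [|q [q1 q2 q3]] := @round_toward0 L y L0.
    rewrite -(expr_le1 (n := 2)) // real_normK ?num_real //.
    by apply: le_trans hxy; rewrite lerDr sqr_ge0.
  by exists (p, q); split => //=; [rewrite lerD|rewrite mulr_natl mulr2n lerD].
pose X : 'M[C]_(r, n) := \matrix_(i, j)
  gridc L (sval (hround i j)).1 (sval (hround i j)).2.
have hX j : nsq (col j X) <= 1.
  apply: le_trans (hZ j); rewrite !nsqE; apply: ler_sum => i _.
  by rewrite !mxE; case: (svalP (hround i j)).
have hd j : nsq (col j (V *m Z) - col j (V *m X)) <= (2 * r%:R / L%:R) ^+ 2.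
  rewrite !colE -!mulmxA -mulmxBr nsq_isometric // -!colE.
  apply: (@le_trans _ _ (r%:R * (2 * L%:R ^- 2))).
    rewrite nsqE mulr_natl -[X in _ *+ X]card_ord -sumr_const ler_sum // => i _.
    by rewrite !mxE; case: (svalP (hround i j)).
  rewrite exprMn exprVn mulrA ler_wpM2r ?invr_ge0 ?exprn_ge0 //.
  rewrite -!natrM -natrX ler_nat; case: (r) => [//|k]; nia.
have e0 : 0 <= 2 * r%:R / L%:R :> R by rewrite divr_ge0 ?mulr_ge0.
have hVc (W : 'M[C]_(r, n)) j : nsq (col j (V *m W)) = nsq (col j W).
  by rewrite colE -mulmxA nsq_isometric // -colE.
have hVZ j : nsq (col j (V *m Z)) <= 1 by rewrite hVc.
have hVX j : nsq (col j (V *m X)) <= 1 by rewrite hVc.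
have h2 := round_columns psi1 e0 hVZ hVX hd.
have h3 : csq (amplitude psi (V *m X)) <= b.
  apply: hb => // i j; exists (sval (hround i j)).1, (sval (hround i j)).2.
  by rewrite mxE; case: (svalP (hround i j)).
have h4 : n%:R * (eps / (2 * n%:R)) = eps / 2.
  by field; rewrite gt_eqF.
have h5 : n%:R * (2 * (2 * r%:R / L%:R)) <= eps / 2.
  have -> : n%:R * (2 * (2 * r%:R / L%:R)) = (8 * n%:R * r%:R) / L%:R / 2 :> R.
    by field; rewrite gt_eqF.
  by rewrite ler_wpM2r ?invr_ge0 // ler_pdivrMr // (mulrC eps).
rewrite h4 in h1; exact: le_halves h1 h2 h3 h5.
Qed.

End Density.

(** * Compressed forms *)

Section Families.
Variables (R : realType) (m : nat).
Local Notation C := R[i].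
Local Notation cV := 'cV[C]_m.
Implicit Types (F G : 'M[C]_m) (B : nat -> cV).

Lemma csq_rsqrtC (x : R) : 0 < x -> csq (sqrtC x%:C)^-1 * x = 1.
Proof.
move=> x0; apply: complexI; rewrite rmorphM /= csqE.
have s0 : 0 <= sqrtC (x%:C) :> C by rewrite sqrtC_ge0 ler0c ltW.
rewrite geC0_conj ?invr_ge0 // -expr2 exprVn sqrtCK mulVf //.
by rewrite eq_complex /= gt_eqF.
Qed.

Definition forthonormal F k B :=
  forall i j, (i < k)%N -> (j < k)%N -> dot (B i) (F *m B j) = (i == j)%:R.

Lemma dot_hermC F x y : F^t* = F -> dot y (F *m x) = Num.conj (dot x (F *m y)).
Proof. by move=> hF; rewrite dot_conj dot_adjl hF. Qed.

Lemma dot_herm F x : F^t* = F -> dot x (F *m x) = (qform F x)%:C.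
Proof.
move=> hF; have := dot_hermC x x hF; rewrite /qform; case: dot => a b [] e.
by congr (_ +i* _); lra.
Qed.

Lemma qform_scale F (a : C) x : qform F (a *: x) = csq a * qform F x.
Proof.
by rewrite /qform -scalemxAr dotZl dotZr mulrA -csqE ReZ.
Qed.

Lemma forthonormal_step F k B B' w : F^t* = F -> forthonormal F k B ->
  (forall i, (i < k)%N -> dot (B i) (F *m w) = 0) -> 0 < qform F w ->
  (forall j, j != k -> B' j = B j) ->
  B' k = (sqrtC (dot w (F *m w)))^-1 *: w -> forthonormal F k.+1 B'.
Proof.
move=> hF hB hw qw hB' hk i j; rewrite !ltnS.
have lt_ne a : (a < k)%N -> a != k by move=> h; rewrite ltn_eqF.
rewrite leq_eqVlt => /predU1P[->|ik]; rewrite leq_eqVlt => /predU1P[->|jk].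
- rewrite hk dot_herm // dot_herm // qform_scale.
  by rewrite eqxx csq_rsqrtC.
- rewrite dot_hermC // hk hB' ?lt_ne // -scalemxAr dotZr hw // mulr0 rmorph0.
  by rewrite gtn_eqF.
- by rewrite hk hB' ?lt_ne // -scalemxAr dotZr hw // mulr0 ltn_eqF.
- by rewrite !hB' ?lt_ne // hB.
Qed.

Lemma forthonormal_mx F B : forthonormal F m B ->
  (\matrix_(i, j) B j i 0)^t* *m F *m (\matrix_(i, j) B j i 0) = 1%:M :> 'M[C]_m.
Proof.
move=> hB; set A := \matrix_(i, j) B j i 0.
have colA j : col j A = B j by apply/matrixP => a b; rewrite !mxE ord1.
apply/matrixP => i j; rewrite -mulmxA mulmx_dot colA.
have -> : col j (F *m A) = F *m B j by rewrite colE -mulmxA -colE colA.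
by rewrite hB // mxE.
Qed.

Lemma forthonormal_pd F B x : forthonormal F m B -> x != 0 -> 0 < qform F x.
Proof.
move=> /forthonormal_mx; set A := (\matrix_(i, j) _) => hA x0.
have hI : A *m (A^t* *m F) = 1%:M by apply: mulmx1C.
have ex : x = A *m (A^t* *m F *m x) by rewrite mulmxA hI mul1mx.
have -> : qform F x = nsq (A^t* *m F *m x).
  by rewrite {1 2}ex /qform dot_adjl !mulmxA hA mul1mx.
rewrite lt_def nsq_ge0 andbT; apply: contraNneq x0 => /nsq_eq0 e.
by rewrite ex e mulmx0.
Qed.

Definition deflate F (v : cV) : 'M[C]_m :=
  F - (v *m (F *m v)^t* + (F *m v) *m v^t*) + (dot v (F *m v) + 1) *: (v *m v^t*).

Lemma outer_mul (u v x : cV) : u *m v^t* *m x = dot v x *: u.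
Proof. by rewrite -mulmxA mx11_dot mul_mx_scalar. Qed.

Lemma deflate_mul F (v x : cV) : deflate F v *m x =
  F *m x - (dot (F *m v) x *: v + dot v x *: (F *m v))
   + ((dot v (F *m v) + 1) * dot v x) *: v.
Proof.
rewrite /deflate mulmxDl mulmxBl mulmxDl -scalemxAl -scalerA.
by rewrite !outer_mul.
Qed.

Lemma deflate_herm F (v : cV) : F^t* = F -> (deflate F v)^t* = deflate F v.
Proof.
move=> hF; rewrite /deflate ctmxD ctmxB ctmxD ctmxZ !ctmxM !ctmxK hF.
rewrite [v *m (v^t* *m F) + _]addrC rmorphD rmorph1 /= dot_conj.
by rewrite dot_adjl hF.
Qed.

Lemma deflate_self F (v : cV) : F^t* = F -> dot v v = 1 -> deflate F v *m v = v.
Proof.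
move=> hF hv; rewrite deflate_mul hv mulr1 scale1r dot_adjl hF.
rewrite scalerDl !scale1r; move: (F *m v) (dot v (F *m v) *: v) => z a.
by rewrite [a + z]addrC opprD (addrA z) subrr add0r addrA addNr add0r.
Qed.

Lemma deflate_fix F (v w : cV) : F^t* = F -> dot v w = 0 -> F *m w = w ->
  deflate F v *m w = w.
Proof.
move=> hF hv hw; rewrite deflate_mul dot_adjl hF hw hv mulr0 !scale0r.
by rewrite !addr0 subr0.
Qed.

Lemma deflate_perp F (v x : cV) : dot v x = 0 ->
  qform (deflate F v) x = qform F x.
Proof.
move=> hv; rewrite /qform deflate_mul hv mulr0 !scale0r !addr0 dotBr dotZr.
by rewrite -(dot_conj v) hv rmorph0 mulr0 subr0.
Qed.

(* [v] collects the directions already split off from the form [G], and [F] is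
   [G] compressed to their orthogonal complement, plus the identity on them. *)
Record compression G r (v : nat -> cV) F : Prop := Compression {
  compression_herm : F^t* = F;
  compression_on : forthonormal 1%:M r v;
  compression_fix : forall i, (i < r)%N -> F *m v i = v i;
  compression_perp : forall x, (forall i, (i < r)%N -> dot (v i) x = 0) ->
    qform F x = qform G x;
  compression_neg : forall i, (i < r)%N -> qform G (v i) <= 0 }.

Lemma compression0 G (v : nat -> cV) : G^t* = G -> compression G 0 v G.
Proof. by move=> hG; split. Qed.

Lemma compression_step G r (v v' : nat -> cV) F w (c : nat -> C)
    (p := w - \sum_(i < r) c i *: v i) :
  compression G r v F -> w != 0 -> qform F w <= 0 ->
  (forall i, (i < r)%N -> dot (v i) p = 0) ->
  (forall j, j != r -> v' j = v j) -> v' r = (sqrtC (dot p p))^-1 *: p ->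
  compression G r.+1 v' (deflate F (v' r)).
Proof.
case=> hF hon hfix hperp hneg w0 qw hp hv' hr.
set y := \sum_(i < r) c i *: v i in p hp hr.
have Fy : F *m y = y.
  by rewrite mulmx_sumr; apply: eq_bigr => i _; rewrite -scalemxAr hfix.
have py : dot p y = 0.
  rewrite dot_sumr big1 // => i _.
  by rewrite dotZr -dot_conj hp // rmorph0 mulr0.
have yp : dot y p = 0 by rewrite -dot_conj py rmorph0.
have wE : w = p + y by rewrite subrK.
clearbody p y.
have qE : qform F w = qform F p + nsq y.
  rewrite /qform wE mulmxDr Fy dotDl !dotDr py addr0.
  by rewrite (dot_adjr F y) hF Fy yp add0r ReD.
have p0 : 0 < nsq p.
  rewrite lt_def nsq_ge0 andbT; apply: contra w0 => /eqP/nsq_eq0 e.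
  move: qw; rewrite qE e /qform dot0l add0r => qw.
  have /nsq_eq0 y0 : nsq y = 0 by apply/eqP; rewrite eq_le qw nsq_ge0.
  by rewrite wE e y0 addr0.
have qp : qform G p <= 0.
  rewrite -hperp //; have := nsq_ge0 y; move: qw; rewrite qE.
  by move: (qform F p) (nsq y) => a b *; lra.
have hon' : forthonormal 1%:M r.+1 v'.
  apply: (forthonormal_step (ctmx1 _ _) hon (w := p) _ _ hv'); rewrite ?mul1mx.
  - by move=> i ir; rewrite hp.
  - by rewrite qform1.
  - exact: hr.
have nr : dot (v' r) (v' r) = 1.
  by have := hon' r r (ltnSn r) (ltnSn r); rewrite mul1mx eqxx.
have vlt i : (i < r)%N -> v' i = v i by move=> ir; rewrite hv' // ltn_eqF.
split; [exact: deflate_herm|exact: hon'| | |].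
- move=> i; rewrite ltnS leq_eqVlt => /predU1P[->|ir]; first exact: deflate_self.
  apply: deflate_fix => //; last by rewrite vlt // hfix.
  have := hon' r i (ltnSn r) (ltnW ir); rewrite mul1mx gtn_eqF //.
- move=> x hx; rewrite deflate_perp ?hx // hperp // => i ir.
  by rewrite -vlt // hx // ltnW.
- move=> i; rewrite ltnS leq_eqVlt => /predU1P[->|ir]; last by rewrite vlt // hneg.
  by rewrite hr qform_scale; exact: mulr_ge0_le0 (csq_ge0 _) qp.
Qed.

Lemma compression_pd_full G (v : nat -> cV) F x :
  compression G m v F -> x != 0 -> 0 < qform F x.
Proof.
case=> hF hon hfix _ _; apply: (@forthonormal_pd F v) => i j im jm.
by rewrite hfix // -(hon i j im jm) mul1mx.
Qed.

End Families.

(** * Digits and orthonormalisation *)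

Section Digits.
Local Open Scope nat_scope.

Definition digit (b t k : nat) : nat := (t %/ b ^ k) %% b.

Lemma digits_surj b D (d : nat -> nat) : 0 < b -> (forall k, d k < b) ->
  exists2 t, t < b ^ D & forall k, k < D -> digit b t k = d k.
Proof.
move=> b0; elim: D d => [|D IH] d hd.
  by exists 0; rewrite ?expn0.
have [t ht hk] := IH (fun k => d k.+1) (fun k => hd k.+1).
exists (d 0 + t * b).
  rewrite expnSr; apply: (@leq_trans (b + t * b)); first by rewrite ltn_add2r.
  by rewrite -mulSn leq_mul2r ht orbT.
case=> [|k] kD; rewrite /digit.
  by rewrite expn0 divn1 addnC modnMDl modn_small.
by rewrite expnS divnMA addnC divnMDl // (divn_small (hd 0)) addn0 -hk.
Qed.

Lemma digit_div b t j k : digit b (t %/ b ^ j) k = digit b t (j + k).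
Proof. by rewrite /digit expnD divnMA. Qed.

End Digits.

Section GramSchmidt.
Variables (R : realType) (m : nat).
Local Notation C := R[i].
Local Notation cV := 'cV[C]_m.

(* Gram-Schmidt with zero vectors in place of the failing steps, which are
   recorded by the flag. *)
Record gram_schmidt (k flag : nat) (y B : nat -> cV) : Prop := GramSchmidt {
  gs_orth : forall i j, (i < k)%N -> (j < k)%N -> i != j -> dot (B i) (B j) = 0;
  gs_norm : forall i, (i < k)%N -> dot (B i) (B i) = 1 \/ B i = 0;
  gs_ok : flag = 0%N -> forall i, (i < k)%N -> dot (B i) (B i) = 1;
  gs_fail : flag != 0%N -> exists2 i, (i < k)%N & B i = 0;
  gs_span : exists T : nat -> nat -> C, forall j, (j < k)%N ->
    y j = \sum_(i < k) T i j *: B i }.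

Lemma gram_schmidt0 y B : gram_schmidt 0 0 y B.
Proof. by split=> //; exists (fun _ _ => 0). Qed.

Lemma gram_schmidt_step k flag flag' y B B' w (c : nat -> C) :
  gram_schmidt k flag y B -> w = y k - \sum_(i < k) c i *: B i ->
  (forall i, (i < k)%N -> dot (B i) w = 0) ->
  (forall j, j != k -> B' j = B j) ->
  B' k = (sqrtC (dot w w))^-1 *: w ->
  flag' = (if complex.Re (dot w w) <= 0 then 1%N else flag) ->
  gram_schmidt k.+1 flag' y B'.
Proof.
move=> [ho hn hok hfail [T hT]] hw hperp hold hk ->.
have lt_ne a : (a < k)%N -> a != k by move=> h; rewrite ltn_eqF.
have hB a : (a < k)%N -> B' a = B a by move=> h; rewrite hold // lt_ne.
rewrite -/(nsq w).
have w0 : nsq w <= 0 -> w = 0.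
  by move=> h; apply: nsq_eq0; apply/eqP; rewrite eq_le h nsq_ge0.
have hk1 : 0 < nsq w -> dot (B' k) (B' k) = 1.
  by move=> h; rewrite hk dotvv nsqZ dotvv csq_rsqrtC.
have wE : w = sqrtC (dot w w) *: B' k.
  have [/w0 ->|h] := leP (nsq w) 0.
    by rewrite dot0l sqrtC0 scale0r.
  rewrite hk scalerA mulfV ?scale1r // sqrtC_eq0 dotvv eq_complex /=.
  by rewrite gt_eqF.
split.
- move=> i j; rewrite !ltnS leq_eqVlt => /predU1P[->|ik];
    rewrite leq_eqVlt => /predU1P[->|jk] ij.
  + by rewrite eqxx in ij.
  + by rewrite hk hB // dotZl -(dot_conj (B j)) hperp // rmorph0 mulr0.
  + by rewrite hk hB // dotZr hperp // mulr0.
  + by rewrite !hB // ho.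
- move=> i; rewrite ltnS leq_eqVlt => /predU1P[->|ik]; last by rewrite hB //; apply: hn.
  have [/w0 e|/hk1] := leP (nsq w) 0; last by left.
  by right; rewrite hk e scaler0.
- have [//|h] := leP (nsq w) 0 => fl i; rewrite ltnS leq_eqVlt => /predU1P[->|ik].
    exact: hk1.
  by rewrite hB // hok.
- have [h _|_ /hfail[i ik hi]] := leP (nsq w) 0.
    by exists k => //; rewrite hk (w0 h) scaler0.
  by exists i; rewrite ?hB // ltnW.
- exists (fun i j => if (j < k)%N then (if (i < k)%N then T i j else 0)
                     else (if (i < k)%N then c i else sqrtC (dot w w))).
  move=> j; rewrite ltnS leq_eqVlt => /predU1P[->|jk]; rewrite big_ord_recr /=.
    rewrite !ltnn -wE; apply/eqP; rewrite addrC -subr_eq; apply/eqP.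
    rewrite [in RHS]hw; congr (_ - _); apply: eq_bigr => i _.
    by rewrite ltn_ord hB.
  rewrite jk ltnn scale0r addr0 hT //; apply: eq_bigr => i _.
  by rewrite ltn_ord hB.
Qed.

Variables (n : nat) (psi : fock R m).
Hypothesis psi1 : normalized psi.

Lemma gram_schmidt_amplitude flag y B (A Y : 'M[C]_(m, n)) :
  gram_schmidt n flag y B -> (forall j : 'I_n, col j A = B j) ->
  (forall j : 'I_n, col j Y = y j) ->
  (flag = 0%N -> isometric A /\ ((forall j, nsq (col j Y) <= 1) ->
     csq (amplitude psi Y) <= csq (amplitude psi A))) /\
  (flag != 0%N -> amplitude psi Y = 0).
Proof.
move=> [ho hn hok hfail [T hT]] hA hY.
have eY : Y = A *m \matrix_(i, j) T i j.
  apply/matrixP => i j; have := hY j; rewrite hT // => /matrixP /(_ i 0).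
  rewrite mxE => ->; rewrite mxE summxE; apply: eq_bigr => k _.
  by rewrite -hA !mxE mulrC.
split=> [fl|/hfail[k kn hk]]; last first.
  by apply: (amplitude_factor_zero psi (k := Ordinal kn) _ eY); rewrite hA.
have iA : isometric A.
  apply/matrixP => i j; rewrite mulmx_dot !hA mxE.
  by have [<-|ij] := eqVneq i j; [rewrite hok|rewrite ho].
split; first exact: iA.
exact: amplitude_isometric_ge iA eY.
Qed.

End GramSchmidt.

(** * Reasoning about programs *)

Fixpoint wregs (c : cmd) : seq nat :=
  match c with
  | SetReg x _ => [:: x]
  | Seq c1 c2 | If _ c1 c2 => wregs c1 ++ wregs c2
  | While _ c1 => wregs c1
  | _ => [::]
  end.

Fixpoint warrs (c : cmd) : seq nat :=
  match c with
  | SetCell a _ _ _ => [:: a]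
  | Query _ b _ _ => [:: b]
  | Seq c1 c2 | If _ c1 c2 => warrs c1 ++ warrs c2
  | While _ c1 => warrs c1
  | _ => [::]
  end.

(* The running time is at most [Z ^ depth c] as soon as [Z] bounds the number
   of iterations of every loop. *)
Fixpoint depth (c : cmd) : nat :=
  match c with
  | Skip => 1
  | SetReg _ e => (ncost e).+1
  | SetCell _ i j e => (ncost i + ncost j + ccost e).+1
  | Query _ _ i j => (ncost i + ncost j).+3
  | Seq c1 c2 => (maxn (depth c1) (depth c2)).+2
  | If b c1 c2 => (bcost b + maxn (depth c1) (depth c2)).+2
  | While b c1 => (bcost b + depth c1).+3
  end%N.

Definition inc (x : nat) : cmd := SetReg x (NAdd (NReg x) (NConst 1)).

Definition For (x y : nat) (body : cmd) : cmd :=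
  Seq (SetReg x (NConst 0))
      (While (BNot (BLeN (NReg y) (NReg x))) (Seq body (inc x))).

Section Run.
Variables (R : realType) (m n : nat) (O : 'M[R[i]]_(m, n) -> R[i]) (Z : nat).
Hypothesis Z2 : (1 < Z)%N.
Local Notation C := R[i].
Local Notation state := (state R).
Implicit Types (c : cmd) (s : state).

Definition agree c s s' : Prop :=
  (forall x, x \notin wregs c -> reg s' x = reg s x) /\
  (forall a, a \notin warrs c -> cell s' a = cell s a).

Lemma exec_agree c s t q s' : exec O c s t q s' -> agree c s s'.
Proof.
elim=> {c s t q s'} //=.
- by move=> s x e; split=> // y; rewrite inE /= => /negPf ->.
- move=> s a i j e; split=> // b; rewrite inE => /negPf h.
  by apply/funext => i'; apply/funext => j' /=; rewrite h.
- move=> s a b i j _; split=> // d; rewrite inE => /negPf h.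
  by apply/funext => i'; apply/funext => j' /=; rewrite h.
- move=> s s1 s2 c1 c2 t1 t2 q1 q2 _ [h1 h2] _ [h3 h4]; split=> [x|a] /=;
    by rewrite mem_cat negb_or => /andP[k1 k2]; rewrite ?h3 ?h1 ?h4 ?h2.
- move=> s s1 b c1 c2 t q _; case: ifP => _ [h1 h2]; split=> [x|a] /=;
    by rewrite mem_cat negb_or => /andP[k1 k2]; rewrite ?h1 ?h2.
- move=> s s1 s2 b c t1 t2 q1 q2 _ _ [h1 h2] _ [h3 h4].
  by split=> [x|a] /= h; rewrite ?h3 ?h1 ?h4 ?h2.
Qed.

Definition run c s (Q : nat) (P : state -> Prop) : Prop :=
  exists t q s', [/\ exec O c s t q s', (t <= Z ^ depth c)%N, (q <= Q)%N & P s'].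

Lemma run_mono c s Q (P P' : state -> Prop) : run c s Q P ->
  (forall s', agree c s s' -> P s' -> P' s') -> run c s Q P'.
Proof.
move=> [t [q [s' [h1 h2 h3 h4]]]] h; exists t, q, s'; split=> //.
exact: h (exec_agree h1) h4.
Qed.

Lemma run_queries c s Q Q' P : run c s Q P -> (Q <= Q')%N -> run c s Q' P.
Proof.
move=> [t [q [s' [h1 h2 h3 h4]]]] h; exists t, q, s'; split=> //.
exact: leq_trans h3 h.
Qed.

Let expZ_gt0 k : (0 < Z ^ k)%N. Proof. by rewrite expn_gt0; lia. Qed.

Let ltZ k : (k < Z ^ k)%N. Proof. exact: ltn_expl. Qed.

Let leZ j k : (j <= k)%N -> (Z ^ j <= Z ^ k)%N.
Proof. by move=> h; rewrite leq_exp2l. Qed.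

Let dblZ a : (a + a <= Z * a)%N.
Proof. by rewrite addnn -mul2n leq_mul2r Z2 orbT. Qed.

Lemma run_skip s (P : state -> Prop) : P s -> run Skip s 0 P.
Proof.
by move=> h; exists 1%N, 0%N, s; split; [exact: ExecSkip|exact: expZ_gt0| |].
Qed.

Lemma run_setreg s x e (P : state -> Prop) :
  P (set_reg s x (neval s e)) -> run (SetReg x e) s 0 P.
Proof.
move=> h; exists (ncost e).+1, 0%N, (set_reg s x (neval s e)).
by split; [exact: ExecSetReg|exact: ltnW (ltZ _)| |].
Qed.

Lemma run_setcell s a i j e (P : state -> Prop) :
  P (set_cell s a (neval s i) (neval s j) (ceval s e)) ->
  run (SetCell a i j e) s 0 P.
Proof.
move=> h; exists (ncost i + ncost j + ccost e).+1, 0%N.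
exists (set_cell s a (neval s i) (neval s j) (ceval s e)).
by split; [exact: ExecSetCell|exact: ltnW (ltZ _)| |].
Qed.

Lemma run_query s a b i j (P : state -> Prop) : (m <= Z)%N -> (n <= Z)%N ->
  isometric (read_matrix m n s a) ->
  P (set_cell s b (neval s i) (neval s j) (O (read_matrix m n s a))) ->
  run (Query a b i j) s 1 P.
Proof.
move=> hm hn hi h; exists (ncost i + ncost j + m * n).+1, 1%N.
exists (set_cell s b (neval s i) (neval s j) (O (read_matrix m n s a))).
split=> //; first exact: ExecQuery.
have := ltZ (ncost i + ncost j); have := leq_mul hm hn.
rewrite [depth _]/= !expnS; set k := (ncost i + ncost j)%N.
move: (Z ^ k)%N (m * n)%N => E p h1 h2.
have -> : (Z * (Z * (Z * E)) = Z * (Z * Z * E))%N by lia.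
have h3 : (p <= Z * Z * E)%N by rewrite -[p]muln1 leq_mul //; lia.
have h4 : (k < Z * Z * E)%N by nia.
by move: (Z * Z * E)%N h3 h4 => q h3 h4; nia.
Qed.

Lemma run_seq2 c1 c2 s Q1 Q2 (P : state -> Prop) :
  run c1 s Q1 (fun s1 => run c2 s1 Q2 P) -> run (Seq c1 c2) s (Q1 + Q2) P.
Proof.
move=> [t1 [q1 [s1 [h1 ht1 hq1 [t2 [q2 [s2 [h2 ht2 hq2 hP]]]]]]]].
exists (t1 + t2).+1, (q1 + q2)%N, s2; split=> //; last exact: leq_add.
  exact: ExecSeq h1 h2.
rewrite /=; set d := maxn _ _.
have k1 : (t1 <= Z ^ d)%N by rewrite (leq_trans ht1) // leZ // leq_maxl.
have k2 : (t2 <= Z ^ d)%N by rewrite (leq_trans ht2) // leZ // leq_maxr.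
have := expZ_gt0 d; rewrite !expnS; have := dblZ (Z ^ d); have := dblZ (Z * Z ^ d).
by move: (Z ^ d)%N k1 k2 => *; lia.
Qed.

Lemma run_seq c1 c2 s Q (P : state -> Prop) :
  run c1 s 0 (fun s1 => run c2 s1 Q P) -> run (Seq c1 c2) s Q P.
Proof. exact: run_seq2. Qed.

Lemma run_seql c1 c2 s Q (P : state -> Prop) :
  run c1 s Q (fun s1 => run c2 s1 0 P) -> run (Seq c1 c2) s Q P.
Proof. by move=> h; rewrite -[Q]addn0; apply: run_seq2. Qed.

Lemma run_if b c1 c2 s Q (P : state -> Prop) :
  (beval s b -> run c1 s Q P) -> (~~ beval s b -> run c2 s Q P) ->
  run (If b c1 c2) s Q P.
Proof.
move=> h1 h2.
have [t [q [s' [h ht hq hP]]]] : run (if beval s b then c1 else c2) s Q P.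
  by case: ifPn => [/h1|/h2].
exists (bcost b + t).+1, q, s'; split=> //; first exact: ExecIf.
rewrite /=; set d := maxn _ _.
have k : (t <= Z ^ d)%N.
  by rewrite (leq_trans ht) // leZ // /d; case: ifP; rewrite ?leq_maxl ?leq_maxr.
have := ltZ (bcost b); have := expZ_gt0 d; have := expZ_gt0 (bcost b).
rewrite !expnS expnD.
move: (bcost b) (Z ^ bcost b)%N (Z ^ d)%N k => b' z d' k z0 d0 zb.
have h3 : (b' < z * d')%N by nia.
have h4 : (t <= z * d')%N by nia.
have := dblZ (z * d'); have := dblZ (Z * (z * d')); lia.
Qed.

Lemma run_while b c s Q K (Inv : nat -> state -> Prop) : (K <= Z)%N ->
  Inv K s ->
  (forall k s1, agree c s s1 -> Inv k s1 -> beval s1 b ->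
     (0 < k)%N /\ run c s1 Q (Inv k.-1)) ->
  run (While b c) s (K * Q) (fun s' => (exists k, Inv k s') /\ ~~ beval s' b).
Proof.
move=> KZ hI hstep.
suff [t [q [s' [h ht hq hP]]]] : exists t q s', [/\ exec O (While b c) s t q s',
   (t <= K * (bcost b + Z ^ depth c).+1 + (bcost b).+1)%N, (q <= K * Q)%N &
   (exists k, Inv k s') /\ ~~ beval s' b].
  exists t, q, s'; split=> //; apply: leq_trans ht _ => /=.
  have := ltZ (bcost b); have := expZ_gt0 (depth c).
  rewrite !expnS expnD.
  move: (bcost b) (Z ^ bcost b)%N (Z ^ depth c)%N => b' z d d0 zb.
  have h1 : (K * (b' + d).+1 <= Z * (b' + d).+1)%N by rewrite leq_mul2r KZ orbT.
  have h2 : ((b' + d).+1 <= Z * (z * d))%N by have := dblZ (z * d); nia.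
  have h3 : (Z * (b' + d).+1 <= Z * (Z * (z * d)))%N by rewrite leq_mul2l h2 orbT.
  have h4 : (b' < z * d)%N by nia.
  have := dblZ (Z * (z * d)); have := dblZ (z * d).
  by have := dblZ (Z * (Z * (z * d))); lia.
have : agree c s s by [].
have : forall s1, agree c s s1 -> Inv K s1 -> exists t q s', [/\ exec O (While b c) s1 t q s',
   (t <= K * (bcost b + Z ^ depth c).+1 + (bcost b).+1)%N, (q <= K * Q)%N &
   (exists k, Inv k s') /\ ~~ beval s' b]; last by move=> h ?; apply: h.
elim: K {KZ hI} => [|K IH] s1 a1 hI; have [hb|hb] := boolP (beval s1 b).
- by have [] := hstep _ _ a1 hI hb.
- exists (bcost b).+1, 0%N, s1; split=> //; first exact: ExecWhileF.
  by split=> //; exists 0%N.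
- have [_ [t [q [s2 [h ht hq hI2]]]]] := hstep _ _ a1 hI hb.
  have a2 : agree c s s2.
    have [k1 k2] := exec_agree h; have [k3 k4] := a1.
    by split=> x hx; rewrite ?k1 ?k3 ?k2 ?k4.
  have [t' [q' [s' [h' ht' hq' hP]]]] := IH _ a2 hI2.
  exists (bcost b + t + t').+1, (q + q')%N, s'; split=> //; last first.
    by rewrite mulSn leq_add.
    by rewrite mulSn; lia.
  exact: ExecWhileT hb h h'.
- exists (bcost b).+1, 0%N, s1; split=> //; first exact: ExecWhileF.
    by rewrite mulSn; lia.
  by split=> //; exists K.+1.
Qed.

Lemma run_while0 b c s K (Inv : nat -> state -> Prop) : (K <= Z)%N ->
  Inv K s ->
  (forall k s1, agree c s s1 -> Inv k s1 -> beval s1 b ->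
     (0 < k)%N /\ run c s1 0 (Inv k.-1)) ->
  run (While b c) s 0 (fun s' => (exists k, Inv k s') /\ ~~ beval s' b).
Proof.
move=> h1 h2 h3; apply: run_queries (run_while h1 h2 h3) _.
by rewrite muln0.
Qed.

Lemma run_for x y body s Q (Inv : nat -> state -> Prop) :
  x != y -> x \notin wregs body -> y \notin wregs body -> (reg s y <= Z)%N ->
  Inv 0%N (set_reg s x 0) ->
  (forall i s1, (i < reg s y)%N -> agree (For x y body) s s1 -> reg s1 x = i ->
     Inv i s1 -> run body s1 Q (fun s2 => Inv i.+1 (set_reg s2 x i.+1))) ->
  run (For x y body) s (reg s y * Q) (fun s' => Inv (reg s y) s').
Proof.
move=> xy xb yb hN h0 hstep; apply: run_seq; apply: run_setreg => /=.
set s0 := set_reg s x 0; set N := reg s y.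
pose J k s1 := exists i, [/\ (i + k = N)%N, reg s1 x = i, reg s1 y = N & Inv i s1].
apply: run_mono (@run_while _ _ s0 Q N J hN _ _) _.
- exists 0%N; split=> //; rewrite /s0 /set_reg /=; first by rewrite eqxx.
  by rewrite eq_sym (negPf xy).
- move=> k s1 [a1 a2] [i [e1 e2 e3 e4]] /=; rewrite e2 e3 -ltnNge => iN.
  split; first lia; apply: run_seql.
  apply: run_mono (hstep i s1 iN _ e2 e4) _; last first.
    move=> s2 [b1 b2] h2; apply: run_setreg => /=.
    have e5 : reg s2 x = i by rewrite b1.
    exists i.+1; split=> //=; first lia.
    + by rewrite eqxx e5 addn1.
    + by rewrite eq_sym (negPf xy) b1.
    + by rewrite e5 addn1.
  split=> [z|a] /=.
    rewrite inE mem_cat inE !negb_or => /and3P[zx zb _].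
    rewrite a1 /= ?mem_cat ?inE ?negb_or ?zx ?zb //.
    by rewrite (negPf zx).
  by move=> ha; rewrite a2.
- move=> s' _ [[k [i [e1 e2 e3 e4]]]] /=; rewrite e2 e3 -ltnNge -leqNgt => hi.
  by have <- : i = N by lia.
Qed.

Lemma run_for0 x y body s (Inv : nat -> state -> Prop) :
  x != y -> x \notin wregs body -> y \notin wregs body -> (reg s y <= Z)%N ->
  Inv 0%N (set_reg s x 0) ->
  (forall i s1, (i < reg s y)%N -> agree (For x y body) s s1 -> reg s1 x = i ->
     Inv i s1 -> run body s1 0 (fun s2 => Inv i.+1 (set_reg s2 x i.+1))) ->
  run (For x y body) s 0 (fun s' => Inv (reg s y) s').
Proof.
move=> *; apply: run_queries (run_for _ _ _ _ _ _) _; try eassumption.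
by rewrite muln0.
Qed.

End Run.

(** * The program *)

(* Registers: 0 and 1 hold n and m, 2 the dimension of the subspace, 3 the flag
   of failing Gram-Schmidt steps, 4 the column treated by such a step, 12 the
   mesh L of the grid, 13 the number 2L+1 of digits, 15 the size of the net.
   Register 5 is never written: it only names the column of the vectors stored
   in arrays 6 and 8.  The others are counters and scratch.
   Arrays: 3 basis of the subspace, 4 current form, 5 identity, 6 current
   vector, 7 Gram-Schmidt output, 8 form applied to the new basis vector,
   9 result of Form, 10 amplitude, 11 best squared amplitude so far. *)
Definition ForCol (a y j : nat) (e : cexp) : cmd :=
  For 10 y (SetCell a (NReg 10) (NReg j) e).

Definition ForMx (a y1 y2 : nat) (e : cexp) : cmd :=
  For 10 y1 (For 11 y2 (SetCell a (NReg 10) (NReg 11) e)).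

Definition acc : cexp := CCell 9 (NConst 0) (NConst 0).

Definition Form (ax jx f ay jy : nat) : cmd :=
  Seq (SetCell 9 (NConst 0) (NConst 0) (CNat (NConst 0)))
      (For 10 1 (For 11 1 (SetCell 9 (NConst 0) (NConst 0)
         (CAdd acc (CMul (CConj (CCell ax (NReg 10) (NReg jx)))
            (CMul (CCell f (NReg 10) (NReg 11))
                  (CCell ay (NReg 11) (NReg jy)))))))).

Definition wcell : cexp := CCell 6 (NReg 10) (NReg 5).

(* Modified Gram-Schmidt for the form in array [f]: orthogonalises the vector in
   array 6 against the columns of [A] before column [reg 4] and appends it. *)
Definition Step (f A : nat) : cmd :=
  Seq (For 6 4 (Seq (Form A 6 f 6 5)
                    (ForCol 6 1 5 (CAdd wcell
                       (COpp (CMul acc (CCell A (NReg 10) (NReg 6))))))))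
  (Seq (Form 6 5 f 6 5)
  (Seq (ForCol A 1 4 (CMul (CInv (CSqrt acc)) wcell))
       (If (BLeC acc (CNat (NConst 0))) (SetReg 3 (NConst 1)) Skip))).

Section Macros.
Variables (R : realType) (m n : nat) (O : 'M[R[i]]_(m, n) -> R[i]) (Z : nat).
Hypothesis Z2 : (1 < Z)%N.
Local Notation C := R[i].
Local Notation state := (state R).
Local Notation run := (run O Z).
Implicit Types (c : cmd) (s : state).

Definition mxof k l (c : nat -> nat -> C) : 'M[C]_(k, l) := \matrix_(i, j) c i j.
Definition cv (c : nat -> nat -> C) (j : nat) : 'cV[C]_m := \col_i c i j.

Lemma run_forcol a y j e s (g : nat -> C) :
  y != 10%N -> j != 10%N -> (reg s y <= Z)%N ->
  (forall k s1, (k < reg s y)%N -> (forall x, x != 10%N -> reg s1 x = reg s x) ->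
     reg s1 10%N = k -> (forall b, b != a -> cell s1 b = cell s b) ->
     cell s1 a k (reg s j) = cell s a k (reg s j) -> ceval s1 e = g k) ->
  run (ForCol a y j e) s 0 (fun s' => cell s' a =
    fun i j' => if (i < reg s y)%N && (j' == reg s j) then g i else cell s a i j').
Proof.
move=> y10 j10 hZ he.
apply: (run_for0 Z2 (Inv := fun k s' => cell s' a =
  fun i j' => if (i < k)%N && (j' == reg s j) then g i else cell s a i j')) => //.
  by rewrite eq_sym.
move=> k s1 kN [a1 a2] e1 e2; apply: run_setcell => //=.
apply/funext => i; apply/funext => j'.
have -> : reg s1 j = reg s j by rewrite a1 //= !inE orbb.
rewrite eqxx /= e1 e2 [in RHS]ltnS [in RHS]leq_eqVlt.
rewrite (he k s1) //.
- by case: (eqVneq i k) => [->|_] //=; case: (j' == _); rewrite ?ltnn.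
- by move=> x x10; rewrite a1 //= !inE orbb.
- by move=> b ba; rewrite a2 //= inE.
- by rewrite e2 ltnn.
Qed.

Lemma run_formx a y1 y2 e s (g : nat -> nat -> C) :
  y1 != 10%N -> y1 != 11%N -> y2 != 10%N -> y2 != 11%N ->
  (reg s y1 <= Z)%N -> (reg s y2 <= Z)%N ->
  (forall k l s1, (k < reg s y1)%N -> (l < reg s y2)%N ->
     (forall x, x != 10%N -> x != 11%N -> reg s1 x = reg s x) ->
     reg s1 10%N = k -> reg s1 11%N = l ->
     (forall b, b != a -> cell s1 b = cell s b) ->
     cell s1 a k l = cell s a k l -> ceval s1 e = g k l) ->
  run (ForMx a y1 y2 e) s 0 (fun s' => cell s' a =
    fun i j => if (i < reg s y1)%N && (j < reg s y2)%N then g i j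
               else cell s a i j).
Proof.
move=> h1 h2 h3 h4 hZ1 hZ2 he.
apply: (run_for0 Z2 (Inv := fun k s' => cell s' a =
  fun i j => if (i < k)%N && (j < reg s y2)%N then g i j
             else cell s a i j)) => //=.
- by rewrite eq_sym.
- by rewrite !inE orbb.
move=> k s1 kN [a1 a2] e1 e2.
have r2 : reg s1 y2 = reg s y2.
  by rewrite a1 //= !inE !negb_or h3 h4.
rewrite /= in a1 a2.
apply: run_mono (run_for0 Z2 (Inv := fun l s' => cell s' a =
  fun i j => if ((i < k) || (i == k) && (j < l))%N && (j < reg s y2)%N
             then g i j else cell s a i j) _ _ _ _ _ _) _ => //=.
- by rewrite eq_sym.
- by rewrite r2.
- rewrite e2; apply/funext => i; apply/funext => j.
  by rewrite ltn0 andbF orbF.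
- move=> l s2; rewrite r2 => lN [b1 b2] e3 e4; apply: run_setcell => //=.
  rewrite /= in b1 b2.
  have e5 : reg s2 10%N = k by rewrite b1.
  apply/funext => i; apply/funext => j; rewrite eqxx /= e3 e5 e4.
  rewrite (he k l s2) //.
  + have [->|ik] := eqVneq i k; last by rewrite /= ?orbF.
    rewrite ltnn /= ltnS [in RHS]leq_eqVlt.
    by have [->|] := eqVneq j l; rewrite /= ?lN.
  + move=> x x10 x11; rewrite b1 ?inE ?negb_or ?x11 //.
    by rewrite a1 // !inE !negb_or x10 x11.
  + by move=> b ba; rewrite b2 ?a2 //= ?inE.
  + by rewrite e4 ltnn eqxx ltnn.
- move=> s2 _ ->; apply/funext => i; apply/funext => j; rewrite r2.
  by rewrite ltnS [in RHS]leq_eqVlt; case: eqVneq; case: (i < k)%N; case: (j < _)%N.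
Qed.

Lemma run_form ax jx f ay jy s :
  [&& ax != 9, f != 9, ay != 9, jx \notin [:: 10; 11] & jy \notin [:: 10; 11]]%N ->
  reg s 1 = m -> (m <= Z)%N ->
  run (Form ax jx f ay jy) s 0 (fun s' => cell s' 9%N 0%N 0%N =
    dot (cv (cell s ax) (reg s jx))
        (mxof m m (cell s f) *m cv (cell s ay) (reg s jy))).
Proof.
case/and5P=> hax hf hay hjx hjy r1 hZ.
apply: run_seq => //; apply: run_setcell => //=.
pose x i := cell s ax i (reg s jx); pose F := cell s f.
pose y j := cell s ay j (reg s jy).
pose t i j := Num.conj (x i) * (F i j * y j).
have -> : dot (cv (cell s ax) (reg s jx))
        (mxof m m (cell s f) *m cv (cell s ay) (reg s jy)) =
   \sum_(0 <= i < m) \sum_(0 <= j < m) t i j.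
  rewrite dotE big_mkord; apply: eq_bigr => i _; rewrite !mxE mulr_sumr big_mkord.
  by apply: eq_bigr => j _; rewrite !mxE.
apply: run_mono (run_for0 Z2 (Inv := fun k s' => cell s' 9%N 0%N 0%N =
  \sum_(0 <= i < k) \sum_(0 <= j < m) t i j) _ _ _ _ _ _) _ => //=; last by move=> s' _; rewrite r1.
- by rewrite r1.
- by rewrite big_nil.
rewrite r1 => k s1 kN [a1 a2] e1 e2; rewrite /= in a1 a2.
apply: run_mono (run_for0 Z2 (Inv := fun l s' => cell s' 9%N 0%N 0%N =
  \sum_(0 <= i < k) \sum_(0 <= j < m) t i j + \sum_(0 <= j < l) t k j)
  _ _ _ _ _ _) _ => //=.
- by rewrite a1 //= r1.
- by rewrite big_nil addr0.
- rewrite a1 //= r1 => l s2 lN [b1 b2] e3 e4; rewrite /= in b1 b2.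
  apply: run_setcell => //=; rewrite e4 big_nat_recr //= addrA; congr (_ + _).
  have rj j : j \notin [:: 10; 11]%N -> reg s2 j = reg s j.
    rewrite !inE negb_or => /andP[k1 k2].
    by rewrite b1 ?a1 // !inE ?negb_or ?k1 ?k2.
  rewrite e3 (b1 10%N) // e1 !rj // !b2 ?inE // !a2 ?inE //.
  by rewrite (negPf hax) (negPf hf) (negPf hay).
- by move=> s2 _ ->; rewrite a1 //= r1 big_nat_recr.
Qed.

Lemma run_step f A s (w := cv (cell s 6) (reg s 5)) (F := mxof m m (cell s f))
    (k := reg s 4) (B := cv (cell s A)) :
  [&& f != 9, f != 6, f != A, A != 9 & A != 6]%N ->
  reg s 1 = m -> (m <= Z)%N -> (k <= Z)%N -> 
  (forall i j, (i < k)%N -> (j < k)%N -> i != j -> dot (B i) (F *m B j) = 0) ->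
  (forall i, (i < k)%N -> dot (B i) (F *m B i) = 1 \/ B i = 0) ->
  run (Step f A) s 0 (fun s' =>
    let w' := cv (cell s' 6) (reg s' 5) in
    let d := dot w' (F *m w') in
    [/\ (exists c : nat -> C, w' = w - \sum_(i < k) c i *: B i),
        (forall i, (i < k)%N -> dot (B i) (F *m w') = 0),
        (forall j, j != k -> cv (cell s' A) j = B j),
        cv (cell s' A) k = (sqrtC d)^-1 *: w' &
        reg s' 3 = if complex.Re d <= 0 then 1%N else reg s 3]).
Proof.
case/and5P=> f9 f6 fA A9 A6 r1 hm hk orth nrm.
apply: run_seq => //.
apply: run_mono (run_for0 Z2 (Inv := fun j s' =>
   let w' := cv (cell s' 6) (reg s' 5) in
   [/\ (exists c : nat -> C, w' = w - \sum_(i < j) c i *: B i) &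
       (forall i, (i < j)%N -> dot (B i) (F *m w') = 0)]) _ _ _ _ _ _) _ => //=.
- by split=> //; exists (fun _ => 0); rewrite big_ord0 subr0.
- move=> j s1 jk [a1 a2] e1 [[c hc] ho]; rewrite /= in a1 a2.
  apply: run_seq => //; apply: run_mono (run_form _ _ _) _ => //.
  + by rewrite A9 f9.
  + by rewrite a1.
  move=> s2 [b1 b2]; rewrite /= in b1 b2.
  have cAs : cell s1 A = cell s A by rewrite a2 // !inE !negb_or A9 A6.
  rewrite e1 cAs (a2 f) ?inE ?negb_or ?f9 ?f6 // -/F -/(B j).
  set w1 := cv _ _ in hc ho *; move=> hacc.
  set co := dot _ _ in hacc.
  apply: run_mono (run_forcol (g := fun i => cell s1 6 i (reg s1 5) - co * cell s A i j) _ _ _ _) _ => //.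
  + by rewrite b1 // a1 // r1.
  + move=> i s3 iN c1 c2 c3 c4 /=.
    rewrite c2 (c1 5%N) // (c1 6%N) // c4 (c3 9%N) // (c3 A) // hacc.
    by rewrite (b1 5%N) // (b1 6%N) // e1 (b2 A) ?inE ?negb_or ?A9 // cAs (b2 6%N).
  move=> s3 [d1 d2] hw; rewrite /= in d1 d2.
  have ew : cv (cell s3 6) (reg s3 5) = w1 - co *: B j.
    apply/matrixP => i i'; rewrite hw d1 // !mxE b1 // a1 // r1 ltn_ord.
    by rewrite b1 // a1 // eqxx.
  rewrite ew; split.
  + exists (fun i => if (i < j)%N then c i else co).
    rewrite big_ord_recr /= ltnn hc -addrA -opprD; congr (_ - (_ + _)).
    by apply: eq_bigr => i _; rewrite ltn_ord.
  + move=> i; rewrite ltnS leq_eqVlt => ij; rewrite mulmxBr dotBr -scalemxAr dotZr.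
    have [e|ne] := eqVneq i j; last first.
      move: ij; rewrite (negPf ne) /= => ij.
      by rewrite ho // orth ?mulr0 ?subr0 // (ltn_trans ij).
    rewrite e /co; have [->|->] := nrm j jk; first by rewrite mulr1 subrr.
    by rewrite !dot0l mul0r subr0.
move=> s1 [a1 a2] [[c hc] ho]; rewrite /= in a1 a2.
apply: run_seq => //; apply: run_mono (run_form _ _ _) _ => //.
- by rewrite f9.
- by rewrite a1.
move=> s2 [b1 b2]; rewrite /= in b1 b2.
rewrite (a2 f) ?inE ?negb_or ?f9 ?f6 // -/F; set w1 := cv _ _ in hc ho *; set d := dot _ _ => hd.
have c6 : cell s2 6 = cell s1 6 by rewrite b2.
have r5 : reg s2 5 = reg s1 5 by rewrite b1.
apply: run_seq => //.
apply: run_mono (run_forcol (g := fun i => (sqrtC d)^-1 * cell s1 6 i (reg s1 5)) _ _ _ _) _ => //.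
- by rewrite b1 // a1 // r1.
- move=> i s3 iN c1 c2 c3 c4 /=.
  by rewrite !c3 ?[9 == _]eq_sym ?[6 == _]eq_sym ?A9 ?A6 // hd c2 c1 // c6 r5.
move=> s3 [d1 d2] hA; rewrite /= in d1 d2.
have r4 : reg s2 4 = k by rewrite b1 // a1.
have w3 : cv (cell s3 6) (reg s3 5) = w1.
  by rewrite d1 // r5 d2 ?inE 1?eq_sym // c6.
have cA j : cv (cell s3 A) j = if j == k then (sqrtC d)^-1 *: w1 else B j.
  apply/matrixP => i i'; rewrite hA !mxE b1 // a1 // r1 ltn_ord r4 /=.
  by case: eqP => _; rewrite !mxE // b2 ?inE ?negb_or ?A9 // a2 ?inE ?negb_or ?A9 ?A6.
have acc3 : cell s3 9%N 0%N 0%N = d by rewrite d2 // inE eq_sym.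
have rest s4 : (reg s4 5 = reg s3 5) -> cell s4 = cell s3 ->
  reg s4 3 = (if complex.Re d <= 0 then 1%N else reg s 3) ->
  let w' := cv (cell s4 6) (reg s4 5) in
    let d := dot w' (F *m w') in
    [/\ (exists c : nat -> C, w' = w - \sum_(i < k) c i *: B i),
        (forall i, (i < k)%N -> dot (B i) (F *m w') = 0),
        (forall j, j != k -> cv (cell s4 A) j = B j),
        cv (cell s4 A) k = (sqrtC d)^-1 *: w' &
        reg s4 3 = if complex.Re d <= 0 then 1%N else reg s 3].
  move=> q1 q2 q3; rewrite q1 q2 w3 -/d; split=> //=.
  - by exists c.
  - by move=> j /negPf jk; rewrite cA jk.
  - by rewrite cA eqxx.
apply: run_if => //=; rewrite acc3 => hle.
- by apply: run_setreg => //; apply: rest => //=; rewrite hle.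
- apply: run_skip => //; apply: rest => //; rewrite (negPf hle).
  by rewrite d1 // b1 // a1.
Qed.

End Macros.
Arguments run_forcol {R m n O Z} Z2 [a y j e s] g.
Arguments run_formx {R m n O Z} Z2 [a y1 y2 e s] g.
Arguments run_form {R m n O Z} Z2 [ax jx f ay jy s].
Arguments run_step {R m n O Z} Z2 [f A s].

Definition InitId : cmd :=
  For 10 1 (Seq (SetCell 5 (NReg 10) (NReg 10) (CNat (NConst 1)))
                (SetCell 2 (NReg 10) (NReg 10) (CNat (NConst 1)))).

Definition InitForm : cmd :=
  ForMx 4 1 1
    (CAdd (CMul (CMul (CNat (NConst 3)) (CCell 1 (NConst 0) (NConst 0)))
                (CCell 5 (NReg 10) (NReg 11)))
          (COpp (CMul (CMul (CNat (NConst 4)) (CNat (NReg 0)))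
                  (CAdd (CCell 0 (NReg 10) (NReg 11))
                        (CConj (CCell 0 (NReg 11) (NReg 10))))))).

Definition Elim : cmd :=
  For 4 1 (If (BLeN (NReg 3) (NConst 0))
              (Seq (ForCol 6 1 5 (CCell 5 (NReg 10) (NReg 4))) (Step 4 7))
              Skip).

Definition Deflate : cmd :=
  let v i := CCell 3 (NReg i) (NReg 2) in
  let z i := CCell 8 (NReg i) (NReg 5) in
  Seq (For 8 1 (Seq (Form 5 8 4 3 2) (SetCell 8 (NReg 8) (NReg 5) acc)))
  (Seq (Form 3 2 4 3 2)
       (ForMx 4 1 1
          (CAdd (CAdd (CCell 4 (NReg 10) (NReg 11))
                      (COpp (CAdd (CMul (v 10) (CConj (z 11)))
                                  (CMul (z 10) (CConj (v 11))))))
                (CMul (CAdd acc (CNat (NConst 1)))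
                      (CMul (v 10) (CConj (v 11))))))).

Definition Append : cmd :=
  Seq (SetReg 4 (NReg 2)) (Seq (Step 5 3) (Seq Deflate (inc 2))).

Definition PhaseA : cmd :=
  For 7 1 (Seq (SetReg 3 (NConst 0))
          (Seq Elim (If (BLeN (NConst 1) (NReg 3)) Append Skip))).

(** * Correctness of the subspace search *)

Section PhaseA.
Variables (R : realType) (m n : nat) (O : 'M[R[i]]_(m, n) -> R[i]) (Z : nat).
Hypothesis Z2 : (1 < Z)%N.
Hypothesis mZ : (m <= Z)%N.
Local Notation C := R[i].
Local Notation state := (state R).
Local Notation run := (run O Z).
Local Notation cv := (@cv R m).
Implicit Types (c : cmd) (s : state).

Definition idarr (a : nat -> nat -> C) : Prop :=
  forall i j, (i < m)%N -> (j < m)%N -> a i j = (i == j)%:R.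

Lemma mxof_idarr a : idarr a -> mxof m m a = 1%:M.
Proof. by move=> h; apply/matrixP => i j; rewrite !mxE h. Qed.

Lemma dot_idarr a (u : 'cV[C]_m) (i : 'I_m) : idarr a -> dot (cv a i) u = u i 0.
Proof.
move=> h; rewrite dotE (bigD1 i) //= big1 ?addr0 => [|j ji]; last first.
  by rewrite !mxE h // val_eqE (negPf ji) rmorph0 mul0r.
by rewrite !mxE h // eqxx rmorph1 mul1r.
Qed.

Lemma run_elim s (F := mxof m m (cell s 4)) :
  reg s 1 = m -> reg s 3 = 0%N -> F^t* = F -> idarr (cell s 5) ->
  run Elim s 0 (fun s' =>
    (reg s' 3 = 0%N /\ forthonormal F m (cv (cell s' 7))) \/
    (reg s' 3 = 1%N /\ let w := cv (cell s' 6) (reg s' 5) in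
       w != 0 /\ qform F w <= 0)).
Proof.
move=> r1 r3 hF hI.
apply: run_mono (run_for0 Z2 (Inv := fun k s' =>
    [/\ reg s' 3 = 0%N, forthonormal F k (cv (cell s' 7)) &
        forall (i : nat) (l : 'I_m), (i < k)%N -> (i < l)%N ->
           cv (cell s' 7) i l 0 = 0] \/
    (reg s' 3 = 1%N /\ let w := cv (cell s' 6) (reg s' 5) in
       w != 0 /\ qform F w <= 0)) _ _ _ _ _ _) _ => //=.
- by rewrite r1.
- by left; split.
- rewrite r1 => k s1 km [a1 a2] e1 hk; rewrite /= in a1 a2.
  apply: run_if => //= hflag; last first.
    by apply: run_skip => //; right; case: hk => // [] [h]; rewrite h in hflag.
  have {hk hflag} [h3 ho ht] : [/\ reg s1 3 = 0%N, forthonormal F k (cv (cell s1 7)) &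
        forall (i : nat) (l : 'I_m), (i < k)%N -> (i < l)%N ->
           cv (cell s1 7) i l 0 = 0].
    by case: hk => // [] [h]; rewrite h in hflag.
  pose e : 'cV[C]_m := cv (cell s 5) k.
  apply: run_seq => //.
  apply: run_mono (run_forcol Z2 (fun i => cell s 5 i k) _ _ _ _) _ => //.
  + by rewrite a1 // r1.
  + by move=> i s2 iN c1 c2 c3 c4 /=; rewrite c2 c3 // (c1 4%N) // e1 a2.
  move=> s2 [b1 b2] hw; rewrite /= in b1 b2.
  have r21 : reg s2 1 = m by rewrite b1 // a1.
  have r24 : reg s2 4 = k by rewrite b1.
  have c7 : cell s2 7 = cell s1 7 by rewrite b2.
  have c4 : cell s2 4 = cell s 4 by rewrite b2 // a2.
  have w2 : cv (cell s2 6) (reg s2 5) = e.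
    apply/matrixP => i j; rewrite hw !mxE a1 // r1 ltn_ord b1 // a1 // eqxx.
    by [].
  apply: run_mono (run_step Z2 _ _ _ _ _ _) _ => //.
  + by rewrite r24 (leq_trans (ltnW km)).
  + move=> i j; rewrite r24 c7 c4 => ik jk ij; rewrite ho //.
    by rewrite (negPf ij).
  + by move=> i; rewrite r24 c7 c4 => ik; left; rewrite ho // eqxx.
  move=> s3 [d1 d2]; rewrite /= in d1 d2.
  rewrite w2 r24 c4 c7 b1 // h3 -/F; set w := cv (cell s3 6) _.
  case=> [[c hc] hperp hold hnew h33].
  (* the columns found so far are upper triangular, so [w] has entry 1 in row [k] *)
  have wk (l : 'I_m) : (k <= l)%N -> w l 0 = (l == k :> nat)%:R.
    move=> kl; rewrite hc mxE [X in X + _]mxE hI // mxE summxE big1 ?subr0 // => i _.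
    by rewrite mxE ht ?mulr0 ?ltn_ord // (leq_trans (ltn_ord i)).
  have [hle|hgt] := leP (complex.Re (dot w (F *m w))) 0.
    right; rewrite h33 hle; split=> //=; split=> //.
    apply/eqP => w0; have := wk (Ordinal km) (leqnn _).
    by rewrite w0 mxE /= eqxx => /esym/eqP; rewrite oner_eq0.
  left; rewrite h33 leNgt hgt /=; split=> //.
    by apply: forthonormal_step hF ho hperp hgt hold hnew.
  move=> i l; rewrite ltnS leq_eqVlt => /predU1P[->|ik] il.
    by rewrite hnew mxE wk ?(ltnW il) // gtn_eqF // mulr0.
  by rewrite hold ?ltn_eqF // ht.
- move=> s' _; rewrite r1 => -[[h1 h2 _]|]; last by right.
  by left.
Qed.

Lemma run_deflate s (F := mxof m m (cell s 4)) (v := cv (cell s 3) (reg s 2)) :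
  reg s 1 = m -> idarr (cell s 5) ->
  run Deflate s 0 (fun s' => mxof m m (cell s' 4) = deflate F v).
Proof.
move=> r1 hI; apply: run_seq => //.
have [zf zfE] : exists zf : nat -> C,
    forall i, zf i = dot (cv (cell s 5) i) (F *m v) by eexists.
apply: run_mono (run_for0 Z2 (Inv := fun k s' =>
   forall i, (i < k)%N -> cell s' 8 i (reg s 5) = zf i) _ _ _ _ _ _) _ => //=.
- by rewrite r1.
- rewrite r1 => k s1 km [a1 a2] e1 hk; rewrite /= in a1 a2.
  apply: run_seq => //; apply: run_mono (run_form Z2 _ _ _) _ => //.
    by rewrite a1.
  move=> s2 [b1 b2] hacc; rewrite /= in b1 b2.
  apply: run_setcell => //= i; rewrite ltnS leq_eqVlt.
  rewrite b1 // e1 b1 // a1 // eqxx andbT.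
  case: eqVneq => [->|ne] //= ik; last by rewrite b2 // hk.
  by rewrite hacc zfE e1 (a1 2%N isT) (a2 5%N isT) (a2 4%N isT) (a2 3%N isT).
rewrite r1 => s1 [a1 a2] hz; rewrite /= in a1 a2.
apply: run_seq => //; apply: run_mono (run_form Z2 _ _ _) _ => //.
  by rewrite a1.
move=> s2 [b1 b2]; rewrite /= in b1 b2.
rewrite a1 // !a2 // -/F -/v => hacc.
pose vf i := cell s 3 i (reg s 2).
apply: run_mono (run_formx Z2 (fun i j =>
   cell s 4 i j - (vf i * Num.conj (zf j) + zf i * Num.conj (vf j)) +
   (dot v (F *m v) + 1) * (vf i * Num.conj (vf j))) _ _ _ _ _ _ _) _ => //.
- by rewrite b1 // a1 // r1.
- by rewrite b1 // a1 // r1.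
- move=> k l s3; rewrite b1 // a1 // r1 => km lm c1 c2 c3 c4 c5 /=.
  rewrite c2 c3 !(c1 2%N) // !(c1 5%N) // !(b1 2%N) // !(a1 2%N) //.
  rewrite !(b1 5%N) // !(a1 5%N) // c5 !(c4 3%N) // !(c4 8%N) // !(c4 9%N) //.
  by rewrite hacc !(b2 3%N) // !(a2 3%N) // (b2 4%N) // (a2 4%N) // !(b2 8%N) // !hz.
move=> s3 [d1 d2] h4; apply/matrixP => i j; rewrite h4 mxE b1 // a1 // r1.
have zE (k : 'I_m) : zf k = (F *m v) k 0 by rewrite zfE dot_idarr.
rewrite !ltn_ord /= /deflate; move: (dot v _) => d; rewrite !zE.
move: (F *m v) => z; rewrite !mxE !big_ord1 !mxE.
by [].
Qed.

Variables (eps : R) (gh : 'M[C]_m).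
Local Notation G := (gap_form n eps gh).

Definition phaseA_inv (s' : state) : Prop :=
  compression G (reg s' 2) (cv (cell s' 3)) (mxof m m (cell s' 4)).

Lemma run_append s :
  reg s 1 = m -> idarr (cell s 5) -> (reg s 2 < m)%N -> phaseA_inv s ->
  cv (cell s 6) (reg s 5) != 0 ->
  qform (mxof m m (cell s 4)) (cv (cell s 6) (reg s 5)) <= 0 ->
  run Append s 0 (fun s' => reg s' 2 = (reg s 2).+1 /\ phaseA_inv s').
Proof.
move=> r1 hI rm hinv w0 qw; apply: run_seq => //; apply: run_setreg => //=.
apply: run_seq => //.
set s0 := set_reg _ _ _; have hon := compression_on hinv.
have I1 : mxof m m (cell s0 5) = 1%:M by apply: mxof_idarr.
apply: run_mono (run_step Z2 (s:=s0) _ _ _ _ _ _) _ => //=.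
- by rewrite (leq_trans (ltnW rm)).
- by move=> i j ir jr ij; rewrite I1 hon // (negPf ij).
- by move=> i ir; left; rewrite I1 hon // eqxx.
move=> s1 [a1 a2]; rewrite /= in a1 a2.
rewrite [mxof m m (cell s 5)]I1 !mul1mx.
set p := cv (cell s1 6) _ => -[[c hc] hperp hold hnew _].
have r21 : reg s1 2 = reg s 2 by rewrite a1.
apply: run_seq => //; apply: run_mono (run_deflate _ _) _ => //.
- by rewrite a1.
- by rewrite a2.
move=> s2 [b1 b2]; rewrite /= in b1 b2; rewrite r21 (a2 4%N) // => hF.
apply: run_setreg; first exact: Z2.
cbn [neval]; rewrite (b1 2%N isT) (a1 2%N isT) addn1.
split; first by [].
have -> : phaseA_inv (set_reg s2 2 (reg s 2).+1) =
  compression G (reg s 2).+1 (cv (cell s2 3)) (mxof m m (cell s2 4)) by [].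
rewrite hF (b2 3%N isT).
rewrite hc in hperp hnew *.
exact: compression_step hinv w0 qw hperp hold hnew.
Qed.

Lemma run_phaseA s :
  reg s 1 = m -> reg s 2 = 0%N -> idarr (cell s 5) -> G^t* = G ->
  mxof m m (cell s 4) = G ->
  run PhaseA s 0 (fun s' =>
    [/\ (reg s' 2 <= m)%N, phaseA_inv s' &
        forall x, 0 <= qform (mxof m m (cell s' 4)) x]).
Proof.
move=> r1 r2 hI hG h4.
apply: run_mono (run_for0 Z2 (Inv := fun k s' =>
   [/\ (reg s' 2 <= k)%N, phaseA_inv s' &
       reg s' 2 = k \/ forall x, x != 0 -> 0 < qform (mxof m m (cell s' 4)) x])
     _ _ _ _ _ _) _ => //=.
- by rewrite r1.
- rewrite r2; split=> //; last by left.
  by rewrite /phaseA_inv /= r2 h4; apply: compression0.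
- rewrite r1 => k s1 km [a1 a2] e1 [hk hinv hor]; rewrite /= in a1 a2.
  apply: run_seq => //; apply: run_setreg => //=; apply: run_seq => //.
  apply: run_mono (run_elim _ _ _ _) _ => //=.
  + by rewrite a1.
  + exact: compression_herm hinv.
  + by rewrite a2.
  move=> s2 [b1 b2] h2; rewrite /= in b1 b2.
  have r22 : reg s2 2 = reg s1 2 by rewrite b1.
  have c34 : cell s2 3 = cell s1 3 /\ cell s2 4 = cell s1 4 by rewrite !b2.
  have hinv2 : phaseA_inv s2 by rewrite /phaseA_inv r22 !(proj1 c34, proj2 c34).
  apply: run_if => //= hflag.
    case: h2 => [[h]|[h [w0 qw]]]; first by rewrite h in hflag.
    have e2 : reg s1 2 = k.
      case: hor => // hp; exfalso.
      by have := hp _ w0; rewrite -(proj2 c34) ltNge; rewrite (proj2 c34) qw.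
    apply: run_mono (run_append _ _ _ hinv2 w0 _) _.
    + by rewrite b1 // a1.
    + by move=> i j im jm; rewrite b2 // a2 // hI.
    + by rewrite r22 e2.
    + by rewrite (proj2 c34).
    move=> s3 _ [hr3 hi3]; have e3 : reg s3 2 = k.+1 by rewrite hr3 r22 e2.
    by split; [rewrite /= e3|exact: hi3|left].
  apply: run_skip; first exact: Z2.
  case: h2 => [[h ho]|[h]]; last by rewrite h in hflag.
  split; [by rewrite /= r22 leqW|exact: hinv2|right=> x x0].
  by rewrite [cell _ 4]/= (proj2 c34); apply: forthonormal_pd ho x0.
move=> s' _; rewrite r1 => -[h1 h2 h]; split; [exact: h1|exact: h2|move=> x].
have [->|x0] := eqVneq x 0; first by rewrite /qform dot0l.
case: h => h; apply: ltW; last exact: h.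
by move: h2 x0; rewrite /phaseA_inv h; apply: compression_pd_full.
Qed.

End PhaseA.

Definition Mesh : cmd :=
  Seq (SetReg 12 (NConst 1))
  (Seq (While (BNot (BLeC (CMul (CNat (NConst 8)) (CMul (CNat (NReg 0)) (CNat (NReg 2))))
                     (CMul (CNat (NReg 12)) (CCell 1 (NConst 0) (NConst 0)))))
              (inc 12))
       (SetReg 13 (NAdd (NAdd (NReg 12) (NReg 12)) (NConst 1)))).

Definition NetSize : cmd :=
  Seq (SetReg 14 (NConst 0))
  (Seq (For 10 0 (SetReg 14 (NAdd (NReg 14) (NAdd (NReg 2) (NReg 2)))))
  (Seq (SetReg 15 (NConst 1))
       (For 10 14 (Seq (SetReg 16 (NConst 0))
                  (Seq (For 11 13 (SetReg 16 (NAdd (NReg 16) (NReg 15))))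
                       (SetReg 15 (NReg 16))))))).

Definition Digit (x : nat) : cmd :=
  Seq (SetReg 20 (NConst 0))
  (Seq (While (BLeN (NReg 13) (NReg 17))
              (Seq (SetReg 17 (NSub (NReg 17) (NReg 13))) (inc 20)))
  (Seq (SetReg x (NReg 17)) (SetReg 17 (NReg 20)))).

Definition entry : cexp :=
  CMul (CAdd (CAdd (CNat (NReg 18)) (COpp (CNat (NReg 12))))
             (CMul CImag (CAdd (CNat (NReg 19)) (COpp (CNat (NReg 12))))))
       (CInv (CNat (NReg 12))).

Definition Combine : cmd :=
  Seq (ForCol 6 1 5 (CNat (NConst 0)))
      (For 8 2 (Seq (Digit 18) (Seq (Digit 19)
         (ForCol 6 1 5 (CAdd wcell (CMul entry (CCell 3 (NReg 10) (NReg 8)))))))).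

Definition Ask : cmd :=
  let v := CCell 10 (NConst 0) (NConst 0) in
  Seq (Query 7 10 (NConst 0) (NConst 0))
  (Seq (SetCell 10 (NConst 0) (NConst 0) (CMul v (CConj v)))
       (If (BNot (BLeC v (CCell 11 (NConst 0) (NConst 0))))
           (Seq (SetCell 11 (NConst 0) (NConst 0) v)
                (ForMx 2 1 0 (CCell 7 (NReg 10) (NReg 11))))
           Skip)).

Definition Trial : cmd :=
  Seq (SetReg 3 (NConst 0))
  (Seq (SetReg 17 (NReg 7))
  (Seq (For 4 0 (Seq Combine (Step 5 7)))
       (If (BLeN (NReg 3) (NConst 0)) Ask Skip))).

Definition Search : cmd := For 7 15 Trial.

(** * Correctness of the net search *)

Section PhaseB.
Variables (R : realType) (m n : nat) (f : 'M[R[i]]_(m, n) -> R[i]) (Z : nat).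
Hypothesis Z2 : (1 < Z)%N.
Hypothesis mZ : (m <= Z)%N.
Hypothesis nZ : (n <= Z)%N.
Local Notation C := R[i].
Local Notation state := (state R).
Local Notation run := (run f Z).
Local Notation cv := (@cv R m).
Implicit Types (c : cmd) (s : state).

Lemma run_mesh s K (eps : R) : (K < Z)%N -> 0 <= eps ->
  reg s 0 = n -> cell s 1 0 0 = eps%:C ->
  8 * n%:R * (reg s 2)%:R <= K%:R * eps ->
  run Mesh s 0 (fun s' => [/\ (0 < reg s' 12)%N, (reg s' 12 <= K.+1)%N,
    reg s' 13 = (reg s' 12).*2.+1 &
    8 * n%:R * (reg s 2)%:R <= (reg s' 12)%:R * eps]).
Proof.
move=> KZ eps0 r0 ce hK; apply: run_seq => //; apply: run_setreg => //=.
apply: run_seq => //; set s0 := set_reg _ _ _.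
have test L : (complex.Re (8%:R * (n%:R * (reg s 2)%:R) : C) <=
     complex.Re (L%:R * eps%:C : C)) = (8 * n%:R * (reg s 2)%:R <= L%:R * eps).
  rewrite -!(rmorph_nat (real_complex R)) -!rmorphM /=.
  by rewrite mulrA.
apply: run_mono (run_while0 Z2 (ltnW KZ) (Inv := fun k s' =>
   (0 < reg s' 12)%N /\ (reg s' 12 + k = K.+1)%N) _ _) _.
- by rewrite /s0 /= add1n.
- move=> k s1 [a1 a2] [h1 h2]; cbn [beval ceval neval].
  rewrite (a2 1%N) // (a1 0%N) // (a1 2%N) //= r0 ce test => h.
  have k0 : (0 < k)%N.
    rewrite lt0n; apply: contra h => /eqP k0; rewrite (le_trans hK) //.
    have -> : reg s1 12 = K.+1 by lia.
    by rewrite -natr1 mulrDl mul1r lerDl.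
  by split=> //; apply: run_setreg => //=; split; lia.
- move=> s1 [a1 a2] [[k [h1 h2]]]; cbn [beval ceval neval].
  rewrite negbK (a2 1%N) // (a1 0%N) // (a1 2%N) //= r0 ce test.
  move=> h; apply: run_setreg => //=; split=> //; first lia.
  by rewrite addn1 addnn.
Qed.

Lemma run_netsize s (b := reg s 13) (D := (n * (reg s 2 + reg s 2))%N) :
  reg s 0 = n -> (D <= Z)%N -> (b <= Z)%N ->
  run NetSize s 0 (fun s' => reg s' 15 = (b ^ D)%N).
Proof.
move=> r0 DZ bZ; apply: run_seq => //; apply: run_setreg => //=.
apply: run_seq => //.
apply: run_mono (run_for0 Z2 (Inv := fun k s' =>
   reg s' 14 = (k * (reg s 2 + reg s 2))%N) _ _ _ _ _ _) _ => //=.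
- by rewrite r0.
- move=> k s1 kn [a1 a2] e1 h; apply: run_setreg => //=.
  by rewrite h a1 // mulSn addnC.
rewrite r0 -/D => s1 [a1 a2] h14; apply: run_seq => //; apply: run_setreg => //=.
rewrite /= in a1 a2.
apply: run_mono (run_for0 Z2 (Inv := fun k s' =>
   reg s' 15 = (b ^ k)%N) _ _ _ _ _ _) _ => //=.
- by rewrite h14.
- move=> k s2 kn [b1 b2] e1 h; rewrite /= in b1 b2.
  apply: run_seq => //; apply: run_setreg => //=; apply: run_seq => //.
  apply: run_mono (run_for0 Z2 (Inv := fun l s' =>
    reg s' 16 = (l * b ^ k)%N /\ reg s' 15 = (b ^ k)%N) _ _ _ _ _ _) _ => //=.
  + by rewrite b1 // a1.
  + move=> l s3 ln [c1 c2] e2 [h1 h2]; apply: run_setreg => //=.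
    by rewrite h1 h2 mulSn addnC.
  move=> s3 [c1 c2] [h1 h2]; apply: run_setreg => //=.
  by rewrite h1 b1 // a1 // expnS.
by move=> s2 _; rewrite h14.
Qed.

Lemma run_digit x s (b := reg s 13) (q := reg s 17) :
  (0 < b)%N -> (q <= Z)%N -> x \notin [:: 17; 20]%N ->
  run (Digit x) s 0 (fun s' => reg s' x = (q %% b)%N /\ reg s' 17 = (q %/ b)%N).
Proof.
move=> b0 qZ hx; apply: run_seq => //; apply: run_setreg => //=.
apply: run_seq => //; set s0 := set_reg _ _ _.
apply: run_mono (run_while0 Z2 qZ (Inv := fun k s' =>
   (reg s' 17 <= k)%N /\ (reg s' 17 + reg s' 20 * b = q)%N) _ _) _.
- by rewrite /s0 /= mul0n addn0 leqnn.
- move=> k s1 [a1 a2] [h1 h2] /=; rewrite /= in a1 a2; rewrite (a1 13%N) //= -/b => h.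
  split; first lia.
  apply: run_seq => //; apply: run_setreg => //=; apply: run_setreg => //=.
  rewrite (a1 13%N) //= -/b; split; first by move: (reg s1 17) h1 h b0 => *; lia.
  by rewrite addn1 mulSn; move: h2 h; move: (_ * b)%N => *; lia.
move=> s1 [a1 a2] [[k [h1 h2]]] /=; rewrite /= in a1 a2; rewrite (a1 13%N) //= -/b -ltnNge => h.
apply: run_seq => //; apply: run_setreg => //=; apply: run_setreg => //=.
move: hx; rewrite !inE negb_or eq_sym => /andP[x17 x20].
rewrite (negPf x17) eqxx -h2 addnC modnMDl modn_small // divnMDl //.
by rewrite divn_small // addn0 eq_sym (negPf x20).
Qed.

Lemma ceval_entry s : ceval s entry = gridc R (reg s 12) (reg s 18) (reg s 19).
Proof.
rewrite /= -!(rmorph_nat (real_complex R)) /gridc.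
set L := (reg s 12)%:R; rewrite -fmorphV /=.
by simpc; congr (_ +i* _); ring.
Qed.

Definition net_column (L b q r : nat) (V : nat -> 'cV[C]_m) : 'cV[C]_m :=
  \sum_(i < r) gridc R L (digit b q (i + i)) (digit b q (i + i).+1) *: V i.

Lemma run_combine s (b := reg s 13) (q := reg s 17) (r := reg s 2) :
  reg s 1 = m -> (0 < b)%N -> (q <= Z)%N -> (r <= Z)%N ->
  run Combine s 0 (fun s' =>
    cv (cell s' 6) (reg s' 5) = net_column (reg s 12) b q r (cv (cell s 3)) /\
    reg s' 17 = (q %/ b ^ (r + r))%N).
Proof.
move=> r1 b0 qZ rZ; apply: run_seq => //.
apply: run_mono (run_forcol Z2 (fun i => 0) _ _ _ _) _ => //.
  by rewrite r1.
move=> s1 [a1 a2] hw; rewrite /= in a1 a2.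
have w1 : cv (cell s1 6) (reg s1 5) = 0.
  by apply/matrixP => i j; rewrite hw !mxE r1 ltn_ord a1 // eqxx.
have E : reg s1 2 = r by rewrite a1.
apply: run_mono (run_for0 Z2 (Inv := fun k s' =>
    cv (cell s' 6) (reg s' 5) = net_column (reg s 12) b q k (cv (cell s 3)) /\
    reg s' 17 = (q %/ b ^ (k + k))%N) _ _ _ _ _ _) _ => //=.
- by rewrite E.
- by rewrite w1 /net_column big_ord0 a1 // expn0 divn1.
- rewrite E => k s2 kr [b1 b2] e1 [h1 h2]; rewrite /= in b1 b2.
  apply: run_seq => //; apply: run_mono (run_digit _ _ _) _ => //.
  + by rewrite b1 // a1.
  + by rewrite h2 (leq_trans (leq_div _ _)).
  move=> s3 [c1 c2] [h3 h4]; rewrite /= in c1 c2.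
  have r13 : reg s2 13 = b by rewrite b1 // a1.
  rewrite h2 r13 -divnMA -expnSr in h3 h4.
  apply: run_seq => //; apply: run_mono (run_digit _ _ _) _ => //.
  + by rewrite c1 // r13.
  + by rewrite h4 (leq_trans (leq_div _ _)).
  move=> s4 [d1 d2] [h5 h6]; rewrite /= in d1 d2.
  rewrite (c1 13%N) // r13 h4 in h5; rewrite (c1 13%N) // r13 h4 -divnMA -expnSr in h6.
  have r41 : reg s4 1 = m by rewrite d1 // c1 // b1 // a1.
  apply: run_mono (run_forcol Z2 (fun i => cell s2 6 i (reg s2 5) +
     gridc R (reg s 12) (digit b q (k + k)) (digit b q (k + k).+1) * cell s 3 i k) _ _ _ _) _ => //.
  + by rewrite r41.
  + move=> i s5 iN f1 f2 f3 f4.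
    rewrite [LHS]/= -[_ * (cell _ 3 _ _)]/(ceval s5 entry * cell s5 3 (reg s5 10) (reg s5 8)).
    rewrite ceval_entry f2 (f1 5%N) // f4 (f3 3%N) // !(f1 12%N, f1 18%N, f1 19%N, f1 8%N) //.
    rewrite h5 (d1 18%N) // h3 (d1 12%N) // (c1 12%N) // (b1 12%N) // (a1 12%N) //.
    rewrite (d1 8%N) // (c1 8%N) // e1 (d2 3%N) // (c2 3%N) // (b2 3%N) // (a2 3%N) //.
    by rewrite (d2 6%N) // (c2 6%N) // (d1 5%N) // (c1 5%N).
  move=> s5 [f1 f2] h7; rewrite /= in f1 f2 *; split.
    rewrite /net_column big_ord_recr /= -/(net_column _ _ _ _ _) -h1.
    apply/matrixP => i j; rewrite h7 !mxE r41 ltn_ord f1 // eqxx /=.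
    by [].
  by rewrite f1 // h6 addSn addnS.
by move=> s' _; rewrite E.
Qed.

End PhaseB.

Section Search.
Variables (R : realType) (m n : nat) (f : 'M[R[i]]_(m, n) -> R[i]) (Z : nat).
Hypothesis Z2 : (1 < Z)%N.
Hypothesis mZ : (m <= Z)%N.
Hypothesis nZ : (n <= Z)%N.
Local Notation C := R[i].
Local Notation state := (state R).
Local Notation run := (run f Z).
Local Notation cv := (@cv R m).
Implicit Types (c : cmd) (s : state).

Definition best s : R := complex.Re (cell s 11 0 0).

Definition record_inv s : Prop :=
  [/\ isometric (read_matrix m n s 2), 0 <= best s &
      best s <= csq (f (read_matrix m n s 2))].

Lemma run_ask s (A := read_matrix m n s 7) :
  reg s 0 = n -> reg s 1 = m -> record_inv s -> isometric A ->
  run Ask s 1 (fun s' =>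
    [/\ record_inv s', best s <= best s' & csq (f A) <= best s']).
Proof.
move=> r0 r1 [h1 h2 h3] hA; apply: run_seql => //.
apply: run_query => //; rewrite -/A; set s1 := set_cell _ _ _ _ _.
have c1 a : a != 10%N -> cell s1 a = cell s a.
  move=> /negPf ha; apply/funext => i; apply/funext => j.
  by rewrite /s1 /= ha.
have v1 : cell s1 10 0 0 = f A by [].
have R1 x : reg s1 x = reg s x by [].
clearbody s1; apply: run_seq => //; apply: run_setcell => //.
cbn [ceval neval]; rewrite v1 mulrC -[_ * _]csqE.
set s2 := set_cell _ _ _ _ _.
have c2 a : a != 10%N -> cell s2 a = cell s a.
  move=> /negPf ha; apply/funext => i; apply/funext => j.
  by rewrite /s2 /= ha c1 ?ha.
have v2 : cell s2 10 0 0 = (csq (f A))%:C by [].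
have R2 x : reg s2 x = reg s x by rewrite /s2 /= R1.
clearbody s2; apply: run_if => //; cbn [beval ceval neval]; rewrite v2 c2 // -/(best s) [complex.Re _]/= => hcmp.
  apply: run_seq => //; apply: run_setcell => //; cbn [ceval neval]; rewrite v2.
  set s3 := set_cell _ _ _ _ _.
  have c3 a : a != 11%N -> cell s3 a = cell s2 a.
    move=> /negPf ha; apply/funext => i; apply/funext => j.
    by rewrite /s3 /= ha.
  have v3 : cell s3 11 0 0 = (csq (f A))%:C by [].
  have R3 x : reg s3 x = reg s x by rewrite /s3 /= R2.
  clearbody s3.
  apply: run_mono (run_formx Z2 (fun i j => cell s 7 i j) _ _ _ _ _ _ _) _ => //.
  - by rewrite R3 r1.
  - by rewrite R3 r0.
  - by move=> k l s4 kN lN d1 d2 d3 d4 d5; cbn [ceval neval]; rewrite d2 d3 d4 // c3 // c2.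
  move=> s4 [d1 d2] h4; rewrite !R3 r0 r1 in h4.
  have eA : read_matrix m n s4 2 = A.
    by apply/matrixP => i j; rewrite !mxE h4 !ltn_ord.
  have eb : best s4 = csq (f A) by rewrite /best d2 // v3.
  rewrite -ltNge in hcmp; rewrite /record_inv eA eb; split=> //; last exact: ltW.
  by split=> //; apply: csq_ge0.
apply: run_skip => //; rewrite negbK in hcmp.
have eo : read_matrix m n s2 2 = read_matrix m n s 2.
  by apply/matrixP => i j; rewrite !mxE c2.
have eb : best s2 = best s by rewrite /best c2.
by rewrite /record_inv eo eb; split.
Qed.

Definition trial_column (L b r t : nat) (V : nat -> 'cV[C]_m) (j : nat) :=
  net_column L b (t %/ b ^ ((r + r) * j)) r V.

Definition trial_beaten (L b r t : nat) (V : nat -> 'cV[C]_m) (x : R) : Prop :=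
  forall Y : 'M[C]_(m, n),
    (forall j : 'I_n, col j Y = trial_column L b r t V j) ->
    (forall j, nsq (col j Y) <= 1) -> csq (f Y) <= x.

(* The only properties of the oracle that the search relies on. *)
Hypothesis f_gram_schmidt : forall flag y B (A Y : 'M[C]_(m, n)),
  gram_schmidt n flag y B -> (forall j : 'I_n, col j A = B j) ->
  (forall j : 'I_n, col j Y = y j) ->
  (flag = 0%N -> isometric A /\ ((forall j, nsq (col j Y) <= 1) ->
     csq (f Y) <= csq (f A))) /\
  (flag != 0%N -> f Y = 0).

Lemma run_trial s (L := reg s 12) (b := reg s 13) (r := reg s 2)
    (V := cv (cell s 3)) :
  reg s 0 = n -> reg s 1 = m -> idarr m (cell s 5) -> (0 < b)%N ->
  (reg s 7 <= Z)%N -> (r <= Z)%N -> record_inv s ->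
  run Trial s 1 (fun s' =>
    [/\ record_inv s', best s <= best s' & trial_beaten L b r (reg s 7) V (best s')]).
Proof.
move=> r0 r1 hI b0 tZ rZ hrec; set t := reg s 7.
apply: run_seq => //; apply: run_setreg => //=.
apply: run_seq => //; apply: run_setreg => //=.
set s0 := set_reg _ _ _.
pose y := trial_column L b r t V.
apply: run_seq => //.
apply: run_mono (run_for0 Z2 (Inv := fun k s' =>
   reg s' 17 = (t %/ b ^ ((r + r) * k))%N /\
   gram_schmidt k (reg s' 3) y (cv (cell s' 7))) _ _ _ _ _ _) _ => //=.
- by rewrite r0.
- by rewrite muln0 expn0 divn1; split=> //; apply: gram_schmidt0.
- rewrite r0 => k s1 kn [a1 a2] e1 [h1 h2]; rewrite /= in a1 a2.
  apply: run_seq => //; apply: run_mono (run_combine f Z2 mZ nZ _ _ _ _) _ => //.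
  + by rewrite a1 //= r1.
  + by rewrite a1.
  + by rewrite h1 (leq_trans (leq_div _ _)).
  + by rewrite a1.
  move=> s2 [b1 b2]; rewrite /= in b1 b2.
  rewrite h1 !(a1 12%N, a1 13%N, a1 2%N) //= (a2 3%N) //= -/L -/b -/r -/V.
  rewrite -/(trial_column L b r t V k) -/(y k).
  rewrite -divnMA -expnD -mulnSr => -[hw h17].
  have r21 : reg s2 1 = m by rewrite b1 // a1 //= r1.
  have r24 : reg s2 4 = k by rewrite b1 // e1.
  have I2 : mxof m m (cell s2 5) = 1%:M by apply: mxof_idarr; rewrite b2 // a2.
  have c7 : cell s2 7 = cell s1 7 by rewrite b2.
  apply: run_mono (run_step Z2 _ _ _ _ _ _) _ => //.
  + by rewrite r24 ltnW // (leq_trans kn).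
  + by move=> i j; rewrite r24 c7 I2 mul1mx => ik jk; apply: gs_orth h2 _ _ ik jk.
  + by move=> i; rewrite r24 c7 I2 mul1mx => ik; apply: gs_norm h2 _ ik.
  move=> s3 [d1 d2]; rewrite /= in d1 d2.
  rewrite hw r24 c7 I2; set w := cv (cell s3 6) _.
  cbv zeta; rewrite mul1mx => -[[c hc] hperp hold hnew h3]; rewrite d1 // h17; split=> //.
  by apply: gram_schmidt_step h2 hc hperp hold hnew _; rewrite h3 b1.
rewrite r0 => s1 [a1 a2] [_ h2]; rewrite /= in a1 a2.
have eo : read_matrix m n s1 2 = read_matrix m n s 2.
  by apply/matrixP => i j; rewrite !mxE a2.
have eb : best s1 = best s by rewrite /best a2.
have hrec1 : record_inv s1 by rewrite /record_inv eo eb.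
pose A := read_matrix m n s1 7.
have colA (j : 'I_n) : col j A = cv (cell s1 7) j.
  by apply/matrixP => a c; rewrite !mxE.
apply: run_if => //= hflag.
  have fl : reg s1 3 = 0%N by apply/eqP; rewrite -leqn0.
  have gsA Y := f_gram_schmidt (Y := Y) h2 colA.
  have iA : isometric A.
    pose Y : 'M[C]_(m, n) := \matrix_(i, j) y j i 0.
    have hY (j : 'I_n) : col j Y = y j by apply/matrixP => a c; rewrite !mxE ord1.
    by have [/(_ fl)[]] := gsA Y hY.
  apply: run_mono (run_ask _ _ _ _) _ => //; rewrite ?a1 //=.
  move=> s2 _ [k1 k2 k3]; rewrite eb in k2; split=> // Y hY1 hY2.
  have [/(_ fl)[_ h] _] := gsA Y hY1.
  exact: le_trans (h hY2) k3.
apply: run_queries (run_skip _ Z2 _) _ => //; rewrite eb; split=> // Y hY1 hY2.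
have [_ h] := f_gram_schmidt h2 colA hY1.
by rewrite h ?csq0; [case: hrec|rewrite -leqn0].
Qed.

Lemma run_search s (L := reg s 12) (b := reg s 13) (r := reg s 2) (N := reg s 15)
    (V := cv (cell s 3)) :
  reg s 0 = n -> reg s 1 = m -> idarr m (cell s 5) -> (0 < b)%N ->
  (N <= Z)%N -> (r <= Z)%N -> record_inv s ->
  run Search s N (fun s' => record_inv s' /\
    forall t, (t < N)%N -> trial_beaten L b r t V (best s')).
Proof.
move=> r0 r1 hI b0 NZ rZ hrec; rewrite -[X in run _ _ X]muln1.
apply: run_mono (run_for Z2 (Inv := fun k s' => record_inv s' /\
    forall t, (t < k)%N -> trial_beaten L b r t V (best s')) _ _ _ _ _ _) _ => //=.
move=> k s1 kN [a1 a2] e1 [h1 h2]; rewrite /= in a1 a2.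
apply: run_mono (run_trial _ _ _ _ _ _ _) _ => //.
- by rewrite a1.
- by rewrite a1.
- by rewrite a2.
- by rewrite a1.
- by rewrite e1 ltnW // (leq_trans kN).
- by rewrite a1.
move=> s2 _ [k1 k2 k3]; rewrite e1 (a1 12%N) // (a1 13%N) // (a1 2%N) // a2 // in k3.
split=> // t.
rewrite ltnS leq_eqVlt => /predU1P[->//|tk] Y hY1 hY2.
exact: le_trans (h2 t tk Y hY1 hY2) k2.
Qed.

End Search.

Definition prog : cmd :=
  Seq InitId (Seq InitForm (Seq PhaseA (Seq Mesh (Seq NetSize Search)))).

Section Init.
Variables (R : realType) (m n : nat) (f : 'M[R[i]]_(m, n) -> R[i]) (Z : nat).
Hypothesis Z2 : (1 < Z)%N.
Hypothesis mZ : (m <= Z)%N.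
Hypothesis nm : (n <= m)%N.
Local Notation C := R[i].
Local Notation state := (state R).
Local Notation run := (run f Z).
Implicit Types (s : state).

Lemma run_initid s : reg s 1 = m ->
  (forall i j, cell s 5 i j = 0) -> (forall i j, cell s 2 i j = 0) ->
  run InitId s 0 (fun s' => idarr m (cell s' 5) /\ isometric (read_matrix m n s' 2)).
Proof.
move=> r1 z5 z2.
apply: run_mono (run_for0 Z2 (Inv := fun k s' => forall i j,
   cell s' 5 i j = ((i == j) && (i < k)%N)%:R /\
   cell s' 2 i j = ((i == j) && (i < k)%N)%:R) _ _ _ _ _ _) _ => //=.
- by rewrite r1.
- by move=> i j; rewrite andbF z5 z2.
- move=> k s1 kN [a1 a2] e1 h; apply: run_seq => //; apply: run_setcell => //=.
  apply: run_setcell => //= i j; rewrite e1 ltnS [(i <= k)%N]leq_eqVlt.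
  have [h5 h2] := h i j; rewrite h5 h2.
  have [->|ik] := eqVneq i k; last by [].
  by case: (eqVneq j k); rewrite ?eqxx ?ltnn.
move=> s' _; rewrite r1 => h; split=> [i j im jm|].
  by have [-> _] := h i j; rewrite im andbT.
apply/matrixP => i j; rewrite mulmx_dot dotE (bigD1 (widen_ord nm i)) //=.
rewrite !mxE !(proj2 (h _ _)) /= !eqxx !(leq_trans (ltn_ord i) nm) !andbT.
rewrite rmorph1 mul1r big1 ?addr0 // => k ki.
rewrite !mxE !(proj2 (h _ _)); have -> : (k == i :> nat) = false.
  by apply/negbTE; move: ki; rewrite -val_eqE.
by rewrite rmorph0 mul0r.
Qed.

Lemma run_initform s (eps : R) (gh : 'M[C]_m) :
  reg s 1 = m -> reg s 0 = n -> idarr m (cell s 5) ->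
  cell s 1 0 0 = eps%:C -> (forall i j : 'I_m, cell s 0 i j = gh i j) ->
  run InitForm s 0 (fun s' => mxof m m (cell s' 4) = gap_form n eps gh).
Proof.
move=> r1 r0 hI he hg.
pose g i j : C := 3%:R * eps%:C * cell s 5 i j -
   4%:R * n%:R * (cell s 0 i j + (cell s 0 j i)^*%C).
apply: run_mono (run_formx Z2 g _ _ _ _ _ _ _) _ => //.
- by rewrite r1.
- by rewrite r1.
- move=> k l s1 kN lN a1 a2 a3 a4 a5; cbn [ceval neval].
  by rewrite a2 a3 !a4 // a1 // he r0.
move=> s' [a1 a2] h; apply/matrixP => i j; rewrite h r1 mxE !ltn_ord /= /g.
rewrite hI // !hg /gap_form !mxE val_eqE.
by rewrite !rmorphM !rmorph_nat.
Qed.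

End Init.

(** * Main result *)

Section Main.
Variables (R : realType) (m n : nat) (eps : R) (psi : fock R m) (gh : 'M[R[i]]_m).
Hypothesis n0 : (0 < n)%N.
Hypothesis nm : (n <= m)%N.
Hypothesis eps0 : 0 < eps.
Hypothesis psin : n_particle n psi.
Hypothesis psi1 : normalized psi.
Hypothesis hgh : opnorm (gh - rdm1 (pure_state psi)) < eps / (8 * n%:R).

Variables K D : nat.
Hypothesis hK : 32 * n%:R ^+ 3 / eps ^+ 2 <= K%:R :> R.
Hypothesis hD : forall d, d%:R <= 8 * n%:R ^+ 3 / eps :> R -> (d <= D)%N.
Let W := ((K.*2 + 3) ^ D.+1)%N.
Let Z := (m + 2 + W)%N.
Local Notation f := (@amplitude R m n psi).

Lemma net_column_mul r L b t (V : nat -> 'cV[R[i]]_m) (X : 'M[R[i]]_(r, n)) (j : 'I_n) :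
  (forall i : 'I_r, X i j = gridc R L (digit b t (2 * (j * r + i)))
                                     (digit b t (2 * (j * r + i)).+1)) ->
  col j ((\matrix_(i, k) V k i 0) *m X) = trial_column L b r t V j.
Proof.
move=> hX; apply/matrixP => i k; rewrite /trial_column /net_column.
rewrite !mxE summxE; apply: eq_bigr => a _; rewrite !mxE ord1 hX mulrC.
rewrite !digit_div; congr (gridc _ _ (digit _ _ _) (digit _ _ _) * _); lia.
Qed.

Lemma net_covers r L b (X : 'M[R[i]]_(r, n)) : b = L.*2.+1 ->
  (forall i j, exists p q, [/\ (p < L.*2.+1)%N, (q < L.*2.+1)%N &
        X i j = gridc R L p q]) ->
  exists2 t, (t < b ^ (n * (r + r)))%N & forall (i : 'I_r) (j : 'I_n),
    X i j = gridc R L (digit b t (2 * (j * r + i)))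
                      (digit b t (2 * (j * r + i)).+1).
Proof.
move=> hb hX.
have hpq i j : {pq : nat * nat | [/\ (pq.1 < b)%N, (pq.2 < b)%N &
        X i j = gridc R L pq.1 pq.2]}.
  by apply: cid; have [p [q [h1 h2 h3]]] := hX i j; exists (p, q); rewrite hb.
pose d k : nat :=
  match insub (k./2 %% r)%N, insub (k./2 %/ r)%N with
  | Some i, Some j => if odd k then (sval (hpq i j)).2 else (sval (hpq i j)).1
  | _, _ => 0%N
  end.
have b0 : (0 < b)%N by rewrite hb.
have hd k : (d k < b)%N.
  rewrite /d; case: insub => // i; case: insub => // j.
  by case: (svalP (hpq i j)); case: odd.
have [t ht htd] := digits_surj (n * (r + r)) b0 hd.
exists t => // i j.
have lt : ((2 * (j * r + i)).+1 < n * (r + r))%N.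
  have : (j * r + r <= n * r)%N by rewrite addnC -mulSn leq_mul2r ltn_ord orbT.
  by have := ltn_ord i; move: (j * r)%N; rewrite mulnDr; lia.
have hi : (((j * r + i) %% r)%N = i) /\ (((j * r + i) %/ r)%N = j).
  rewrite modnMDl modn_small // divnMDl ?(leq_ltn_trans _ (ltn_ord i)) //.
  by rewrite divn_small // addn0.
rewrite !htd ?(ltnW lt) // /d mul2n -[_.*2.+1./2]/(uphalf _) doubleK.
rewrite uphalf_double /= odd_double /=.
rewrite (proj1 hi) (proj2 hi) !valK.
by case: (svalP (hpq i j)).
Qed.

Lemma run_prog : run f Z prog (input n eps gh) W (fun s' =>
  isometric (read_matrix m n s' 2) /\
  fidelity (pure_state psi) (slater (read_matrix m n s' 2)) >=
     OPT n (pure_state psi) - eps).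
Proof.
have Z2 : (1 < Z)%N by rewrite /Z; lia.
have mZ : (m <= Z)%N by rewrite /Z; lia.
have nZ : (n <= Z)%N by rewrite /Z; lia.
set s0 := input _ _ _.
apply: run_seq => //; apply: run_mono (run_initid f Z2 mZ nm _ _ _) _ => //.
move=> s1 [a1 a2] [hI hout]; rewrite /= in a1 a2.
apply: run_seq => //; apply: run_mono (run_initform f Z2 mZ (eps := eps) (gh := gh) _ _ _ _ _) _ => //.
- by rewrite a1.
- by rewrite a1.
- by rewrite a2.
- by move=> i j; rewrite a2 //= !valK.
move=> s2 [b1 b2] hF; rewrite /= in b1 b2.
apply: run_seq => //; apply: run_mono (run_phaseA f Z2 mZ (eps := eps) (gh := gh) _ _ _ _ _) _ => //.
- by rewrite b1 // a1.
- by rewrite b1 // a1.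
- by rewrite b2.
- exact: gap_form_herm.
move=> s3 [c1 c2] [hr hcomp hpsd]; rewrite /= in c1 c2.
set r := reg s3 2 in hr; set V := cv m (cell s3 3).
pose Vm : 'M[R[i]]_(m, r) := \matrix_(i, k) V k i 0.
have colV k : col k Vm = V k by apply/matrixP => i j; rewrite !mxE.
have hV : isometric Vm.
  apply/matrixP => i j; rewrite mulmx_dot !colV mxE.
  by have := compression_on hcomp (ltn_ord i) (ltn_ord j); rewrite mul1mx.
have hrank : r%:R * eps <= 4 * n%:R ^+ 2.
  apply: (rank_bound psi1 psin n0 eps0 hgh hV) => j.
  by rewrite colV; apply: compression_neg hcomp _ (ltn_ord j).
have hgap x : Vm^t* *m x = 0 -> 0 <= qform (gap_form n eps gh) x.
  move=> hx; rewrite -(compression_perp hcomp) // => i ir.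
  have /matrixP/(_ (Ordinal ir) 0) := hx; rewrite mxE [RHS]mxE => <-.
  by rewrite dotE; apply: eq_bigr => l _; rewrite ctmxE !mxE.
have KW : (K.*2 + 3 <= W)%N by rewrite /W expnS leq_pmulr // expn_gt0 addn3.
have e0 : 0 < eps ^+ 2 by rewrite exprn_gt0.
have hmesh : 8 * n%:R * r%:R <= K%:R * eps.
  have h1 : 8 * n%:R * (r%:R * eps) <= 8 * n%:R * (4 * n%:R ^+ 2) :> R.
    by rewrite ler_wpM2l // mulr_ge0.
  have h2 : 32 * n%:R ^+ 3 <= K%:R * eps ^+ 2 :> R by rewrite -ler_pdivrMr.
  rewrite -(ler_pM2r eps0); move: h1 h2; rewrite !expr2 exprS expr2.
  by move: (n%:R : R) (r%:R : R) (K%:R : R) => x y z *; lra.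
have hDr : (n * (r + r) <= D)%N.
  apply: hD; rewrite ler_pdivlMr // natrM natrD.
  have : 2 * n%:R * (r%:R * eps) <= 2 * n%:R * (4 * n%:R ^+ 2) :> R.
    by rewrite ler_wpM2l // mulr_ge0.
  by rewrite (_ : 2 * n%:R * (4 * n%:R ^+ 2) = 8 * n%:R ^+ 3); [lra|ring].
have r30 : reg s3 0 = n by rewrite c1 // b1 // a1.
have r31 : reg s3 1 = m by rewrite c1 // b1 // a1.
apply: run_seq => //; apply: run_mono (run_mesh f Z2 mZ nZ (K := K) (eps := eps) _ _ _ _ _) _ => //.
- by rewrite /Z; lia.
- exact: ltW.
- by rewrite c2 // b2 // a2.
move=> s4 [d1 d2] [hL0 hLK hb hL]; rewrite /= in d1 d2.
set L := reg s4 12 in hL0 hLK hb hL.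
have r42 : reg s4 2 = r by rewrite d1.
have bW : (reg s4 13 <= K.*2 + 3)%N by rewrite hb; lia.
apply: run_seq => //; apply: run_mono (run_netsize f Z2 nZ _ _ _) _ => //.
- by rewrite d1.
- rewrite r42 (leq_trans hDr) // /Z; apply: leq_trans (leq_addl _ _).
  by rewrite /W (leq_trans (leqnSn D)) // ltnW // ltn_expl // addn3.
- by rewrite (leq_trans bW) // /Z; lia.
move=> s5 [g1 g2] hN; rewrite /= in g1 g2; rewrite r42 in hN.
have r52 : reg s5 2 = r by rewrite g1 // r42.
have r5b : reg s5 13 = L.*2.+1 by rewrite g1.
have NW : (reg s5 15 <= W)%N.
  rewrite hN /W; apply: (@leq_trans ((K.*2 + 3) ^ (n * (r + r)))%N).
    by case: (n * (r + r))%N => // k; rewrite leq_exp2r.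
  by rewrite leq_exp2l ?addn3 // (leq_trans hDr).
have hV5 : cv m (cell s5 3) = V by rewrite g2 // d2.
have hrec : record_inv f s5.
  have z11 : cell s5 11 0 0 = 0 by rewrite g2 // d2 // c2 // b2 // a2.
  split; rewrite /best ?z11 //; last exact: csq_ge0.
  have -> : read_matrix m n s5 2 = read_matrix m n s1 2.
    by apply/matrixP => i j; rewrite !mxE g2 // d2 // c2 // b2.
  exact: hout.
apply: (run_queries _ NW).
have hgs := fun flag y B A Y => @gram_schmidt_amplitude R m n psi flag y B A Y.
apply: run_mono (run_search Z2 mZ nZ hgs _ _ _ _ _ _ hrec) _.
- by rewrite g1 // d1.
- by rewrite g1 // d1.
- by rewrite g2 // d2 // c2 // b2.
- by rewrite r5b.
- by rewrite (leq_trans NW) // /Z leq_addl.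
- by rewrite r52 (leq_trans hr).
rewrite r52 r5b hV5 (g1 12%N) // -/L => s6 _ [[k1 k2 k3] hbeat]; split; first exact: k1.
rewrite fidelityE; apply: le_trans k3.
apply: (search_suffices psi1 n0 eps0 hgh nm hV hL0 _ hgap); first exact: hL.
move=> X hX hX1.
have [t ht htX] := net_covers (erefl L.*2.+1) hX.
rewrite hN hb in hbeat; apply: (hbeat t ht) => j.
  exact: (net_column_mul V (fun i => htX i j)).
by rewrite colE -mulmxA -colE nsq_isometric.
Qed.

End Main.

Lemma sum_le_scaled_product (a b : nat) :
  (0 < a)%N -> (0 < b)%N -> (a + 2 + b <= a * (4 * b))%N.
Proof.
move=> a0 b0; have := leq_pmulr a b0; have := leq_pmull b a0.
by rewrite mulnCA; lia.
Qed.

(* If n / eps >= 2 its logarithm absorbs the constant 276; otherwise n = 1 and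
   the exponent n^3 / eps is below 2. *)
Lemma net_size_bound (R : realType) (n K D : nat) (eps : R) :
  (0 < n)%N -> 0 < eps -> eps <= 1 ->
  K%:R <= 32 * n%:R ^+ 3 / eps ^+ 2 + 1 -> D%:R <= 8 * n%:R ^+ 3 / eps ->
  (4 * (K.*2 + 3) ^ D.+1)%:R <=
    expR (18 * ln 276) * expR (108 * (n%:R ^+ 3 / eps * ln (n%:R / eps))) :> R.
Proof.
move=> n0 eps0 eps1 hK hD.
have [c hc c9] : exists2 c : R, c = 276 & c <= 2 ^+ 9.
  by exists 276 => //; rewrite -natrX ler_nat.
rewrite -hc; have c1 : 1 <= c by lra.
have n1 : 1 <= n%:R :> R by rewrite ler1n.
set x := n%:R / eps; set y := n%:R ^+ 3 / eps.
have nx : n%:R <= x by rewrite /x ler_pdivlMr // ler_piMr // (le_trans ler01).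
have x1 : 1 <= x by apply: le_trans nx.
have n3 : 1 <= n%:R ^+ 3 :> R by rewrite exprn_ege1.
have n30 : n%:R ^+ 3 <= y.
  by rewrite /y ler_pdivlMr // ler_piMr // (le_trans ler01).
have y1 : 1 <= y by apply: le_trans n30.
have xpos : 0 < x by apply: lt_le_trans x1.
have x3 : n%:R ^+ 3 / eps ^+ 2 <= x ^+ 3.
  rewrite /x exprMn -exprVn ler_wpM2l ?(le_trans ler01 n3) //.
  by rewrite ler_weXn2l // invf_ge1.
have base : (4 * (K.*2 + 3))%:R <= c * x ^+ 3 :> R.
  have x31 : 1 <= x ^+ 3 by rewrite exprn_ege1.
  rewrite hc natrM natrD -mul2n natrM; rewrite -mulrA in hK.
  by move: (_ / _) (x ^+ 3) (K%:R : R) hK x3 x31 => a z k *; lra.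
have b1 : 1 <= c * x ^+ 3 by rewrite mulr_ege1 // exprn_ege1.
have lx0 : 0 <= ln x by rewrite ln_ge0.
have l0 : 0 <= ln c :> R by rewrite ln_ge0.
have ln3 : ln (c * x ^+ 3) = ln c + 3 * ln x.
  by rewrite lnM ?posrE ?exprn_gt0 ?(lt_le_trans ltr01 c1) // lnXn // mulr_natl.
apply: (@le_trans _ _ ((c * x ^+ 3) ^+ D.+1)).
  apply: (@le_trans _ _ (((4 * (K.*2 + 3))%:R : R) ^+ D.+1)).
    rewrite -natrX ler_nat expnMn leq_mul2r; apply/orP; right.
    by rewrite -[X in (X <= _)%N]expn1 leq_exp2l.
  by rewrite lerXn2r ?nnegrE // (le_trans ler01).
rewrite -expRD -[X in X ^+ _]lnK ?posrE ?(lt_le_trans ltr01) //.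
rewrite -expRM_natl ler_expR ln3.
have Dy : D.+1%:R <= 9 * y by rewrite -natr1; move: hD; rewrite -mulrA -/y; lra.
have yx : n = 1%N -> y = x by rewrite /y /x => ->; rewrite expr1n.
clearbody y.
apply: (@le_trans _ _ (9 * y * (ln c + 3 * ln x))).
  by rewrite ler_wpM2r // addr_ge0 // mulr_ge0.
suff : 9 * y * ln c <= 18 * ln c + 81 * (y * ln x).
  by move: (ln x) (ln c : R) => a b; lra.
have ylx : 0 <= y * ln x by rewrite mulr_ge0 // (le_trans ler01).
have [x2|x2] := leP 2 x.
  have h2 : ln c <= 9 * ln x.
    rewrite mulr_natl -lnXn // ler_ln ?posrE ?exprn_gt0 ?(lt_le_trans ltr01 c1) //.
    by apply: le_trans c9 _; rewrite lerXn2r ?nnegrE // ltW.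
  have : y * ln c <= 9 * (y * ln x).
    by rewrite mulrCA ler_wpM2l // (le_trans ler01).
  by lra.
have n_1 : n = 1%N.
  apply/eqP; rewrite eqn_leq n0 andbT -ltnS -(ltr_nat R).
  exact: le_lt_trans nx x2.
have : y * ln c <= 2 * ln c by rewrite ler_wpM2r // (yx n_1) ltW.
by lra.
Qed.

Theorem theorem1 (R : realType) :
  exists (prog : cmd) (K C : R) (k : nat),
  forall (m n : nat) (eps : R) (psi : fock R m) (gammah : 'M[R[i]]_m),
    (0 < n)%N -> (n <= m)%N -> 0 < eps -> eps <= 1 ->
    n_particle n psi -> normalized psi ->
    let rho := pure_state psi in
    opnorm (gammah - rdm1 rho) < eps / (8 * n%:R) ->
    let bound := K * expR (C * (n%:R ^+ 3 / eps * ln (n%:R / eps))) in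
    exists (t q : nat) (s : state R),
      let U := read_matrix m n s output_array in
      [/\ exec (@amplitude R m n psi) prog (input n eps gammah) t q s,
          isometric U,
          fidelity rho (slater U) >= OPT n rho - eps,
          q%:R <= bound &
          t%:R <= m%:R ^+ k * bound].
Proof.
pose k := depth prog; pose a : R := expR (18 * ln 276).
exists prog, (a ^+ k), (108 * k%:R), k.
move=> m n eps psi gh n0 nm eps0 eps1 psin psi1 rho hgh bound.
pose K := (Num.trunc (32 * n%:R ^+ 3 / eps ^+ 2)).+1.
pose D := Num.trunc (8 * n%:R ^+ 3 / eps).
have Kge0 : 0 <= 32 * n%:R ^+ 3 / eps ^+ 2 :> R.
  by rewrite divr_ge0 ?mulr_ge0 ?exprn_ge0 // ltW.
have Dge0 : 0 <= 8 * n%:R ^+ 3 / eps :> R.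
  by rewrite divr_ge0 ?mulr_ge0 ?exprn_ge0 // ltW.
have /andP[K1 K2] := truncn_itv Kge0; have /andP[D1 D2] := truncn_itv Dge0.
have hD d : d%:R <= 8 * n%:R ^+ 3 / eps -> (d <= D)%N.
  by move=> h; rewrite -ltnS -(ltr_nat R); apply: le_lt_trans h D2.
have [t [q [s [h1 h2 h3 [h4 h5]]]]] := run_prog n0 nm eps0 psin psi1 hgh (ltW K2) hD.
have hW : (4 * (K.*2 + 3) ^ D.+1)%:R <=
    a * expR (108 * (n%:R ^+ 3 / eps * ln (n%:R / eps))).
  by apply: net_size_bound => //; rewrite /K -natr1 lerD2r.
exists t, q, s; split; [exact: h1|exact: h4|exact: h5| |].
all: set W := ((K.*2 + 3) ^ D.+1)%N in h2 h3 hW.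
all: have W0 : (0 < W)%N by rewrite expn_gt0 addn3.
all: have hWk : ((4 * W) ^ k)%:R <= bound.
1,3: rewrite /bound natrX -mulrA [k%:R * _]mulrC mulrA -[_ * k%:R]mulrC.
1,2: rewrite expRM_natl -exprMn lerXn2r ?nnegrE //.
1,2: by rewrite mulr_ge0 ?expR_ge0.
- apply: le_trans hWk; rewrite ler_nat (leq_trans h3) //.
  apply: (@leq_trans (4 * W)); first by rewrite leq_pmull.
  by rewrite -[X in (X <= _)%N]expn1 leq_pexp2l // muln_gt0.
- apply: (@le_trans _ _ ((m ^ k * (4 * W) ^ k)%:R)).
    rewrite ler_nat -expnMn (leq_trans h2) // -/k leq_exp2r //.
    have m0 : (0 < m)%N by apply: leq_trans nm.
    exact: sum_le_scaled_product.
  by rewrite natrM natrX ler_wpM2l ?exprn_ge0.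
Qed.
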